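(* Let $p>2$ be a prime and let $\chi$ be a primitive Dirichlet character mod $p$. (1) If $\chi(-1)=-1$, then $\sum_{n=1}^{p}\sigma_{2,\mathbb{1},\overline{\chi}}(n)\sigma_{2,\mathbb{1},\chi}(p-n)= -\frac{B_{3,\overline{\chi}}}{6}-\frac{B_{3,\chi}}{6}+\frac{B_{3,\overline{\chi}}B_{3,\chi}}{3B_6}$, $\sum_{n=1}^{p}\sigma_{2,\mathbb{1},\overline{\chi}}(n)\sigma_{4,\mathbb{1},\chi}(p-n)=-\frac{B_{5,\overline{\chi}}}{10}-\frac{B_{3,\chi}}{6}+\frac{4B_{5,\overline{\chi}}B_{3,\chi}}{15B_8}$, $\sum_{n=1}^{p}\sigma_{2,\mathbb{1},\overline{\chi}}(n)\sigma_{6,\mathbb{1},\chi}(p-n)=-\frac{B_{7,\overline{\chi}}}{14}-\frac{B_{3,\chi}}{6}+\frac{5B_{7,\overline{\chi}}B_{3,\chi}}{21B_{10}}$, $\sum_{n=1}^{p}\sigma_{2,\mathbb{1},\overline{\chi}}(n)\sigma_{10,\mathbb{1},\chi}(p-n)=-\frac{B_{11,\overline{\chi}}}{22}-\frac{B_{3,\chi}}{6}+\frac{7B_{11,\overline{\chi}}B_{3,\chi}}{33B_{14}}$, $\sum_{n=1}^{p}\sigma_{4,\mathbb{1},\overline{\chi}}(n)\sigma_{4,\mathbb{1},\chi}(p-n)=-\frac{B_{5,\overline{\chi}}}{10}-\frac{B_{5,\chi}}{10}+\frac{B_{5,\overline{\chi}}B_{5,\chi}}{5B_{10}}$, $\sum_{n=1}^{p}\sigma_{4,\mathbb{1},\overline{\chi}}(n)\sigma_{8,\mathbb{1},\chi}(p-n)=-\frac{B_{9,\overline{\chi}}}{18}-\frac{B_{5,\chi}}{10}+\frac{7B_{9,\overline{\chi}}B_{5,\chi}}{45B_{14}}$,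 $\sum_{n=1}^{p}\sigma_{6,\mathbb{1},\overline{\chi}}(n)\sigma_{6,\mathbb{1},\chi}(p-n)=-\frac{B_{7,\overline{\chi}}}{14}-\frac{B_{7,\chi}}{14}+\frac{B_{7,\overline{\chi}}B_{7,\chi}}{7B_{14}}$. (2) If $\chi(-1)=1$, then $\sum_{n=1}^{p}\sigma_{3,\mathbb{1},\overline{\chi}}(n)\sigma_{3,\mathbb{1},\chi}(p-n)=\frac{B_{4,\overline{\chi}}}{8}+\frac{B_{4,\chi}}{8}-\frac{B_{4,\overline{\chi}}B_{4,\chi}}{4B_{8}}$, $\sum_{n=1}^{p}\sigma_{3,\mathbb{1},\overline{\chi}}(n)\sigma_{5,\mathbb{1},\chi}(p-n)=\frac{B_{6,\overline{\chi}}}{12}+\frac{B_{4,\chi}}{8}-\frac{5B_{6,\overline{\chi}}B_{4,\chi}}{24B_{10}}$, $\sum_{n=1}^{p}\sigma_{3,\mathbb{1},\overline{\chi}}(n)\sigma_{9,\mathbb{1},\chi}(p-n)=\frac{B_{10,\overline{\chi}}}{20}+\frac{B_{4,\chi}}{8}-\frac{7B_{10,\overline{\chi}}B_{4,\chi}}{40B_{14}}$.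
   Context: For a Dirichlet character $\psi$ mod $p$ (with $\psi\ne$ trivial) and an integer $k\ge 2$, define $\sigma_{k-1,\mathbb{1},\psi}(0)=0$ and, for $m\geq1$, $\sigma_{k-1,\mathbb{1},\psi}(m)=\sum_{d_1,d_2>0,\ d_1d_2=m}\psi(d_2)\,d_1^{k-1}$. $B_n$ denotes the $n$-th Bernoulli number, and for a Dirichlet character $\chi$ mod $D$ the generalized Bernoulli numbers $B_{n,\chi}$ are defined by $\sum_{a=1}^{D}\frac{\chi(a)te^{at}}{e^{Dt}-1}=\sum_{n\geq0}B_{n,\chi}\frac{t^n}{n!}$. *)

(* Defs.v *)
From HB Require Import structures.
From mathcomp Require Import all_boot all_order all_algebra.
From mathcomp Require Import reals complex.

Set Implicit Arguments.
Unset Strict Implicit.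
Unset Printing Implicit Defensive.

Import Order.TTheory GRing.Theory Num.Theory.

Local Open Scope ring_scope.

(* A Dirichlet character mod N is represented by its extension by zero to     *)
(* the integers. Since chi 1 is a nonzero idempotent, chi 1 = 1 follows.      *)
Definition dirichlet_character (C : numClosedFieldType) (N : nat) (chi : int -> C) :=
  [/\ (0 < N)%N,
      forall a : int, chi (a + N%:Z) = chi a,
      forall a b : int, chi (a * b) = chi a * chi b
    & forall a : int, (chi a != 0) = coprimez a N%:Z].

(* chi is induced from the modulus d when it agrees with some character mod d *)
(* at all integers coprime to N.                                              *)
Definition induced_from (C : numClosedFieldType) (N : nat) (chi : int -> C) (d : nat) :=
  exists psi : int -> C,
    dirichlet_character d psi /\
    forall a : int, coprimez a N%:Z -> chi a = psi a.

Definition primitive_character (C : numClosedFieldType) (N : nat) (chi : int -> C) :=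
  dirichlet_character N chi /\
  forall d : nat, (d %| N)%N -> (d < N)%N -> ~ induced_from N chi d.

Definition conj_character (C : numClosedFieldType) (chi : int -> C) : int -> C :=
  fun a => (chi a)^*.

(* sigma_{e,1,psi}(m); the sum is empty for m = 0, which gives the value 0.   *)
Definition sigma1 (C : numClosedFieldType) (e : nat) (psi : int -> C) (m : nat) : C :=
  \sum_(1 <= d1 < m.+1) \sum_(1 <= d2 < m.+1 | (d1 * d2 == m)%N)
    psi d2%:Z * d1%:R ^+ e.

(* Formal power series in t, given by their coefficient sequences. *)

Definition fps_mul (F : fieldType) (f g : nat -> F) : nat -> F :=
  fun n => \sum_(i < n.+1) f i * g (n - i)%N.

Fixpoint fps_inv_coefs (F : fieldType) (f : nat -> F) (n : nat) : seq F :=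
  if n is m.+1 then
    let s := fps_inv_coefs f m in
    rcons s (if m == 0%N then (f 0%N)^-1
             else - (f 0%N)^-1 * \sum_(i < m) s`_i * f (m - i)%N)
  else [::].

(* The inverse of f, for f with nonzero constant term: see fps_mulVf. *)
Definition fps_inv (F : fieldType) (f : nat -> F) : nat -> F :=
  fun n => (fps_inv_coefs f n.+1)`_n.

(* e^{xt} *)
Definition fps_exp (F : fieldType) (x : F) : nat -> F :=
  fun n => x ^+ n / n`!%:R.

(* (e^{xt} - 1) / t *)
Definition fps_expm1_div (F : fieldType) (x : F) : nat -> F :=
  fun n => fps_exp x n.+1.

(* n! [t^n] t / (e^t - 1) *)
Definition bernoulli (n : nat) : rat :=
  n`!%:R * fps_inv (fps_expm1_div 1) n.

(* n! [t^n] (\sum_a chi(a) e^{at}) / ((e^{Nt} - 1) / t); the generating       *)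
(* function identity in its usual form is gen_bernoulliP.                     *)
Definition gen_bernoulli (C : numClosedFieldType) (N : nat) (chi : int -> C) (n : nat) : C :=
  n`!%:R *
  fps_mul (fun m => \sum_(1 <= a < N.+1) chi a%:Z * fps_exp a%:R m)
          (fps_inv (fps_expm1_div N%:R)) n.

Section Facts.
Variable F : fieldType.
Implicit Types f g h : nat -> F.

Lemma size_fps_inv_coefs f n : size (fps_inv_coefs f n) = n.
Proof. by elim: n => //= n IH; rewrite size_rcons IH. Qed.

Lemma nth_fps_inv_coefs f n i : (i < n)%N -> (fps_inv_coefs f n)`_i = fps_inv f i.
Proof.
elim: n => // n IH; rewrite ltnS leq_eqVlt => /orP[/eqP-> //|lt_in].
by rewrite /= nth_rcons size_fps_inv_coefs lt_in IH.
Qed.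

Lemma fps_invS f n : (0 < n)%N ->
  fps_inv f n = - (f 0%N)^-1 * \sum_(i < n) fps_inv f i * f (n - i)%N.
Proof.
move=> n_gt0; rewrite {1}/fps_inv /= nth_rcons size_fps_inv_coefs ltnn eqxx.
rewrite -[n == 0%N]negbK -lt0n n_gt0 /=; congr (_ * _).
by apply: eq_bigr => i _; rewrite nth_fps_inv_coefs.
Qed.

Lemma fps_mulVf f : f 0%N != 0 ->
  forall n, fps_mul (fps_inv f) f n = (n == 0%N)%:R.
Proof.
move=> f0 [|n]; rewrite /fps_mul.
  by rewrite big_ord1 /fps_inv /= mulVf.
rewrite big_ord_recr /= subnn [fps_inv f n.+1]fps_invS //.
by rewrite mulrAC mulNr mulVf // mulN1r subrr.
Qed.

Lemma fps_mulA f g h n : fps_mul (fps_mul f g) h n = fps_mul f (fps_mul g h) n.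
Proof.
pose P (u : nat -> F) : {poly F} := \poly_(i < n.+1) u i.
have PE u v m : (m <= n)%N -> fps_mul u v m = (P u * P v)`_m.
  move=> le_mn; rewrite coefM; apply: eq_bigr => i _.
  have le_im : (i <= m)%N by rewrite -ltnS.
  by rewrite !coef_poly !ltnS (leq_trans le_im le_mn)
             (leq_trans (leq_subr _ _) le_mn).
transitivity (P f * P g * P h)`_n.
  rewrite coefM; apply: eq_bigr => i _; have le_in : (i <= n)%N by rewrite -ltnS.
  by rewrite PE // !coef_poly ltnS leq_subr.
rewrite -mulrA coefM; apply: eq_bigr => i _.
have le_in : (i <= n)%N by rewrite -ltnS.
by rewrite PE ?leq_subr // !coef_poly ltnS le_in.
Qed.

Lemma eq_fps_mulr f g h : g =1 h -> fps_mul f g =1 fps_mul f h.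
Proof. by move=> eq_gh n; apply: eq_bigr => i _; rewrite eq_gh. Qed.

Lemma fps_mulr1 f n : fps_mul f (fun m => (m == 0%N)%:R) n = f n.
Proof.
rewrite /fps_mul big_ord_recr /= subnn eqxx mulr1 big1 ?add0r // => i _.
by rewrite subn_eq0 leqNgt ltn_ord mulr0.
Qed.

Lemma fps_mulr_shift f g n : g 0%N = 0 ->
  fps_mul f g n = if n is m.+1 then fps_mul f (fun i => g i.+1) m else 0.
Proof.
move=> g0; case: n => [|n]; rewrite /fps_mul; first by rewrite big_ord1 g0 mulr0.
rewrite big_ord_recr /= subnn g0 mulr0 addr0; apply: eq_bigr => i _.
by rewrite subSn // -ltnS.
Qed.

End Facts.

Section BernoulliGeneratingFunctions.
Variable C : numClosedFieldType.

Let fact_neq0 n : n`!%:R != 0 :> C.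
Proof. by rewrite pnatr_eq0 -lt0n fact_gt0. Qed.

(* (\sum_n B_{n,chi} t^n / n!) (e^{Nt} - 1) = \sum_a chi(a) t e^{at} *)
Lemma gen_bernoulliP (N : nat) (chi : int -> C) : (0 < N)%N -> forall n,
  fps_mul (fun m => gen_bernoulli N chi m / m`!%:R)
          (fun m => fps_exp N%:R m - (m == 0%N)%:R) n =
  if n is m.+1 then \sum_(1 <= a < N.+1) chi a%:Z * fps_exp a%:R m else 0.
Proof.
move=> N_gt0 n; rewrite fps_mulr_shift; last first.
  by rewrite /fps_exp expr0 fact0 divr1 subrr.
case: n => // n; pose S m := \sum_(1 <= a < N.+1) chi a%:Z * fps_exp a%:R m.
have E0 : fps_expm1_div (N%:R : C) 0%N != 0.
  by rewrite /fps_expm1_div /fps_exp expr1 divr1 pnatr_eq0 -lt0n.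
transitivity (fps_mul (fps_mul S (fps_inv (fps_expm1_div N%:R)))
                      (fps_expm1_div N%:R) n).
  apply: eq_bigr => i _; congr (_ * _); last by rewrite /= subr0.
  by rewrite /gen_bernoulli mulrAC divff // mul1r.
by rewrite fps_mulA (eq_fps_mulr S (fps_mulVf E0)) fps_mulr1.
Qed.

End BernoulliGeneratingFunctions.

(* (\sum_n B_n t^n / n!) (e^t - 1) = t *)
Lemma bernoulliP n :
  fps_mul (fun m => bernoulli m / m`!%:R)
          (fun m => fps_exp 1 m - (m == 0%N)%:R) n = (n == 1%N)%:R.
Proof.
rewrite fps_mulr_shift; last by rewrite /fps_exp expr0 fact0 divr1 subrr.
case: n => // n; have E0 : fps_expm1_div (1 : rat) 0%N != 0.
  by rewrite /fps_expm1_div /fps_exp expr1 divr1 oner_eq0.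
rewrite eqSS -(fps_mulVf E0); apply: eq_bigr => i _.
congr (_ * _); last by rewrite /= subr0.
by rewrite /bernoulli mulrAC divff ?mul1r // pnatr_eq0 -lt0n fact_gt0.
Qed.

(* Main.v *)
(* Put k + l = n + 1 for the two weights.  Expanding the divisor sums gives
   S = \sum conj(chi(b)) chi(d) a^(k-1) c^(l-1) over positive solutions of
   a b + c d = p, i.e. over the bases v = (a, c), w = (-d, b) of the lattices
   x = -r y mod p with v and w in the first two open quadrants; the weight is
   chi(r) = chi(d / b).  For each r these bases form a single path, whose steps
   replace (v, w) by (v + w, w) or (v, v + w).

   Evaluate vectors by a linear form x + y z, and let
   psi(X, Y) = \sum_j (B_j / j!) (B_(n+1-j) / (n+1-j)!) X^(j-1) Y^(n-j).  When
   SL_2(Z) has no cusp forms of weight n + 1 there are an explicit function H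
   (a homogenized Bernoulli polynomial) and a constant c with
     X^(n-1) - Y^(n-1) = H(X, Y) - H(X + Y, Y) + c psi(X, X + Y)
                       = H(X, Y) - H(X, X + Y),
   so the sum of v^(n-1) - w^(n-1) along the paths telescopes to boundary terms,
   which give the B_(k,chi) and B_(l,conj chi), plus c times the sum of the
   psi(v, v + w) over the steps (v, w) -> (v + w, w).  The cones on v and v + w
   arising there subdivide the first quadrant, so this last sum is the degree
   n - 1 part of the generating function \sum exp(x + y z) over the lattice
   points of the open first quadrant; weighted by chi(r) and summed over r, this
   function is chi(-1) \sum chi(x) exp(x) \sum conj(chi(y)) exp(y z), which
   yields the product B_(k,chi) B_(l,conj chi).  Comparing the coefficients of
   z^(l-1) gives S. *)

From HB Require Import structures.
Require Import Defs.
From mathcomp Require Import all_boot all_order all_algebra.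
From mathcomp Require Import reals complex.
From mathcomp Require Import boolp zify ring.

Import Order.TTheory GRing.Theory Num.Theory.
Local Open Scope ring_scope.

(** * Formal power series as a commutative ring *)

Definition fps (F : fieldType) : Type := nat -> F.
HB.instance Definition _ (F : fieldType) := gen_eqMixin (fps F).
HB.instance Definition _ (F : fieldType) := gen_choiceMixin (fps F).

Section PowerSeriesRing.
Variable F : fieldType.
Implicit Types f g h : fps F.

Definition fps_zero : fps F := fun=> 0.
Definition fps_opp f : fps F := fun n => - f n.
Definition fps_add f g : fps F := fun n => f n + g n.
Definition fps_const (c : F) : fps F := fun n => if n == 0%N then c else 0.

Fact fps_addA : associative fps_add.
Proof. by move=> f g h; apply/funext => n; rewrite /fps_add addrA. Qed.
Fact fps_addC : commutative fps_add.
Proof. by move=> f g; apply/funext => n; rewrite /fps_add addrC. Qed.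
Fact fps_add0 : left_id fps_zero fps_add.
Proof. by move=> f; apply/funext => n; rewrite /fps_add add0r. Qed.
Fact fps_addN : left_inverse fps_zero fps_opp fps_add.
Proof. by move=> f; apply/funext => n; rewrite /fps_add addNr. Qed.
HB.instance Definition _ :=
  GRing.isZmodule.Build (fps F) fps_addA fps_addC fps_add0 fps_addN.

Fact fps_mulrA : associative (@fps_mul F : fps F -> fps F -> fps F).
Proof. by move=> f g h; apply/funext => n; rewrite fps_mulA. Qed.
Fact fps_mulrC : commutative (@fps_mul F : fps F -> fps F -> fps F).
Proof.
move=> f g; apply/funext => n; rewrite /fps_mul (reindex_inj rev_ord_inj) /=.
by apply: eq_bigr => i _; rewrite mulrC subSS subKn // -ltnS.
Qed.
Lemma fps_const_mul (c : F) f n : fps_mul (fps_const c) f n = c * f n.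
Proof.
rewrite /fps_mul big_ord_recl /= subn0 big1 ?addr0 // => i _.
by rewrite /fps_const /= mul0r.
Qed.
Fact fps_mul1 : left_id (fps_const 1) (@fps_mul F : fps F -> fps F -> fps F).
Proof. by move=> f; apply/funext => n; rewrite fps_const_mul mul1r. Qed.
Fact fps_mulDl :
  left_distributive (@fps_mul F : fps F -> fps F -> fps F) fps_add.
Proof.
move=> f g h; apply/funext => n; rewrite /fps_mul /fps_add -big_split /=.
by apply: eq_bigr => i _; rewrite mulrDl.
Qed.
Fact fps_1_neq0 : fps_const 1 != 0 :> fps F.
Proof.
apply/eqP => /(congr1 (fun f : fps F => f 0%N)) /eqP.
by rewrite /fps_const eqxx (oner_eq0 F).
Qed.
HB.instance Definition _ := GRing.Zmodule_isComNzRing.Build (fps F)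
  fps_mulrA fps_mulrC fps_mul1 fps_mulDl fps_1_neq0.

Lemma fps_addE f g n : (f + g) n = f n + g n. Proof. by []. Qed.
Lemma fps_mulE f g n : (f * g) n = \sum_(i < n.+1) f i * g (n - i)%N.
Proof. by []. Qed.
Lemma fps_sumE I (r : seq I) (P : pred I) (G : I -> fps F) n :
  (\sum_(i <- r | P i) G i) n = \sum_(i <- r | P i) G i n.
Proof. by elim/big_rec2: _ => [|i x y _ <-]. Qed.

Definition fps_X : fps F := fun n => (n == 1%N)%:R.
Lemma fps_XM f n : (fps_X * f) n = if n is m.+1 then f m else 0.
Proof.
rewrite fps_mulE; case: n => [|n]; first by rewrite big_ord1 mul0r.
rewrite big_ord_recl mul0r add0r big_ord_recl /= subSS subn0 mul1r.
by rewrite big1 ?addr0 // => i _; rewrite /fps_X /= mul0r.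
Qed.
(** Cancelling [fps_X] passes from the series [e^{ut} - 1], which have no constant term, to the
    series [fps_expm1_div], which are invertible for [u > 0]. *)
Lemma fps_X_reg : GRing.lreg fps_X.
Proof.
move=> f g fg; apply/funext => n.
by have := congr1 (fun h : fps F => h n.+1) fg; rewrite !fps_XM.
Qed.
End PowerSeriesRing.

(** * Carlitz reciprocity for row and column sums along a lattice ray *)

Section Carlitz.
Variable A : comNzRingType.
Implicit Types (x y : A) (a d : nat).

(* One term per row for the first lattice point strictly to the right of the ray
   through [(d, a)], and one term per column for the first point on or above it *)
Definition row_sum d a x y := \sum_(1 <= n < a.+1) y ^+ n * x ^+ (n * d %/ a).+1.
Definition col_sum d a x y := \sum_(1 <= m < d.+1) x ^+ m * y ^+ ((m * a).-1 %/ d).+1.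

Lemma geometric_sum x m n : (m <= n)%N ->
  (1 - x) * \sum_(m <= i < n) x ^+ i = x ^+ m - x ^+ n.
Proof.
move=> le_mn; rewrite mulr_sumr -[RHS]opprB -(telescope_sumr _ le_mn) -sumrN.
by apply: eq_bigr => i _; rewrite exprS mulrBl mul1r opprB.
Qed.

Lemma geometric_tail x m n : (0 < m <= n)%N ->
  (1 - x) * \sum_(1 <= i < n | (m <= i)%N) x ^+ i = x ^+ m - x ^+ n.
Proof.
case/andP=> m_gt0 le_mn; rewrite -(geometric_sum x _ _ le_mn).
by rewrite (big_nat_widenl _ _ _ _ _ m_gt0).
Qed.

(* Both sides are [(1 - x) * (1 - y)] times the sum of [x ^+ m * y ^+ n] over
   the box [1..d] x [1..a], cut along its diagonal. *)
Lemma carlitz_reciprocity d a x y : (0 < d)%N -> (0 < a)%N ->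
  (1 - x) * col_sum d a x y + (1 - y) * row_sum d a x y =
  x * y * (1 - x ^+ d * y ^+ a).
Proof.
move=> d_gt0 a_gt0.
pose box := \sum_(1 <= m < d.+1) \sum_(1 <= n < a.+1) x ^+ m * y ^+ n.
have boxE : (1 - x) * (1 - y) * box =
    (x - x ^+ d.+1) * (y - y ^+ a.+1).
  rewrite -[x in RHS]expr1 -[y in RHS]expr1 -!geometric_sum // /box.
  rewrite mulrACA mulr_suml; congr (_ * _).
  by apply: eq_bigr => m _; rewrite mulr_sumr.
(* The two conditions read [m a <= n d] and [n d < m a]; the predecessor in [col_sum] assigns the
   points of the diagonal to the columns. *)
have split_box : box =
    \sum_(1 <= m < d.+1) x ^+ m *
      \sum_(1 <= n < a.+1 | (((m * a).-1 %/ d).+1 <= n)%N) y ^+ n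
  + \sum_(1 <= n < a.+1) y ^+ n *
      \sum_(1 <= m < d.+1 | ((n * d %/ a).+1 <= m)%N) x ^+ m.
  under [X in _ = _ + X]eq_bigr do rewrite mulr_sumr big_mkcond.
  rewrite [X in _ = _ + X]exchange_big /= -big_split /=.
  apply: eq_big_nat => m /andP[m_gt0 _]; rewrite mulr_sumr [in RHS]big_mkcond.
  rewrite -big_split; apply: eq_big_nat => n _ /=.
  rewrite !ltn_divLR // prednK ?muln_gt0 ?m_gt0 //.
  by case: leqP => _; rewrite ?addr0 ?add0r // mulrC.
have colE : (1 - y) * \sum_(1 <= m < d.+1) x ^+ m *
      \sum_(1 <= n < a.+1 | (((m * a).-1 %/ d).+1 <= n)%N) y ^+ n =
    col_sum d a x y - y ^+ a.+1 * \sum_(1 <= m < d.+1) x ^+ m.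
  rewrite !mulr_sumr -sumrB; apply: eq_big_nat => m /andP[m_gt0 le_md].
  rewrite mulrCA geometric_tail; first by rewrite mulrBr [y ^+ _ * _]mulrC.
  rewrite /= ltnS ltnW // ltn_divLR // prednK ?muln_gt0 ?m_gt0 //.
  by rewrite mulnC leq_mul2l -ltnS le_md orbT.
have rowE : (1 - x) * \sum_(1 <= n < a.+1) y ^+ n *
      \sum_(1 <= m < d.+1 | ((n * d %/ a).+1 <= m)%N) x ^+ m =
    row_sum d a x y - x ^+ d.+1 * \sum_(1 <= n < a.+1) y ^+ n.
  rewrite !mulr_sumr -sumrB; apply: eq_big_nat => n /andP[n_gt0 le_na].
  rewrite mulrCA geometric_tail; first by rewrite mulrBr [x ^+ _ * _]mulrC.
  by rewrite /= ltnS -[leqRHS](mulKn d a_gt0) leq_div2r // leq_mul2r -ltnS le_na orbT.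
have Gx := geometric_sum x 1 d.+1 isT; have Gy := geometric_sum y 1 a.+1 isT.
move: boxE; rewrite split_box mulrDr -mulrA colE mulrAC rowE => boxE.
apply: (addIr (- (x - x ^+ d.+1) * y ^+ a.+1 - (y - y ^+ a.+1) * x ^+ d.+1)).
transitivity ((x - x ^+ d.+1) * (y - y ^+ a.+1)); last by rewrite !exprS; ring.
by rewrite -boxE -[in x - _](expr1 x) -[in y - _](expr1 y) -Gx -Gy; ring.
Qed.

(** Lowering [d] by [a] lowers every floor of [n d / a] by [n], which the [x ^ n] in [(x y) ^ n]
    restores. *)
Lemma row_sum_shear d a x y : (0 < a < d)%N ->
  row_sum (d - a) a x (x * y) = row_sum d a x y.
Proof.
case/andP=> a_gt0 lt_ad; apply: eq_bigr => n _.
rewrite exprMn_comm; last exact: mulrC.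
rewrite mulrAC mulrC -exprD; congr (_ * _ ^+ _).
by rewrite -[d in RHS](subnK (ltnW lt_ad)) mulnDr divnDMl //; lia.
Qed.

Lemma col_sum_shear d a x y : (0 < d < a)%N ->
  col_sum d (a - d) (x * y) y = col_sum d a x y.
Proof.
case/andP=> d_gt0 lt_da; apply: eq_big_nat => m /andP[m_gt0 _].
rewrite exprMn_comm; last exact: mulrC.
rewrite -mulrA -exprD; congr (_ * _ ^+ _).
have -> : (m * a).-1 = ((m * (a - d)).-1 + m * d)%N by nia.
by rewrite divnDMl //; lia.
Qed.

End Carlitz.

(** * Generating functions of lattice cones *)

Section LatticeCones.
Variable F : numFieldType.
Implicit Types u v w d a : nat.

Local Notation t := (fps_X F).
Local Notation e u := (fps_exp (u%:R : F) : fps F).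
Local Notation E u := (fps_expm1_div (u%:R : F) : fps F).
Local Notation I u := (fps_inv (fps_expm1_div (u%:R : F)) : fps F).

Let fact_neq0 n : n`!%:R != 0 :> F.
Proof. by rewrite pnatr_eq0 -lt0n fact_gt0. Qed.

Lemma fps_expD u v : e (u + v)%N = e u * e v.
Proof.
apply/funext => n; rewrite fps_mulE /fps_exp natrD addrC exprDn mulr_suml.
apply: eq_bigr => i _; have le_in : (i <= n)%N by rewrite -ltnS.
rewrite -(bin_fact le_in) !natrM -mulr_natr.
have := fact_neq0 i; have := fact_neq0 (n - i)%N.
have : 'C(n, i)%:R != 0 :> F by rewrite pnatr_eq0 -lt0n bin_gt0.
by move=> *; field; apply/and3P.
Qed.

Lemma fps_exp0 : e 0%N = 1.
Proof.
apply/funext => -[|n]; first by rewrite /fps_exp expr0 divr1.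
by rewrite /fps_exp expr0n mul0r.
Qed.

Lemma fps_expX u n : e u ^+ n = e (u * n)%N.
Proof.
elim: n => [|n IHn]; first by rewrite muln0 fps_exp0.
by rewrite exprS IHn -fps_expD mulnS.
Qed.

Lemma fps_expm1_divP u : t * E u = e u - 1.
Proof.
apply/funext => n; rewrite fps_XM fps_addE.
case: n => [|n]; last by rewrite -[LHS]addr0; congr (_ + _); rewrite -oppr0.
by rewrite /fps_exp expr0 divr1 -[LHS](subrr (1 : F)).
Qed.

Lemma fps_inv_expm1_divP u : (0 < u)%N -> I u * E u = 1.
Proof.
move=> u_gt0; apply/funext => n; rewrite [LHS]fps_mulVf.
  by case: n.
by rewrite /fps_expm1_div /fps_exp expr1 divr1 pnatr_eq0 -lt0n.
Qed.

(* [t ^ 2] times the sum of [e u] over the integer points [m v + n w] of the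
   open cone spanned by [v] and [d v + a w] *)
Definition cone d a v w : fps F :=
  row_sum _ d a (e v) (e w) * I v * I (d * v + a * w)%N.

(** This is [carlitz_reciprocity] divided by three factors [1 - e u]: the open cone is the open
    quadrant on [v] and [w] minus the points on or above the ray. *)
Lemma cone_colE d a v w : (0 < d)%N -> (0 < a)%N -> (0 < v)%N -> (0 < w)%N ->
  cone d a v w = e (v + w)%N * I v * I w
    - col_sum _ d a (e v) (e w) * I (d * v + a * w)%N * I w.
Proof.
move=> d_gt0 a_gt0 v_gt0 w_gt0; rewrite /cone.
have u_gt0 : (0 < d * v + a * w)%N by rewrite addn_gt0 muln_gt0 d_gt0 v_gt0.
have := carlitz_reciprocity _ d a (e v) (e w) d_gt0 a_gt0.
rewrite !fps_expX -!fps_expD [(v * d)%N]mulnC [(w * a)%N]mulnC.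
rewrite -[1 - e v]opprB -[1 - e w]opprB -[1 - e (_ + _)%N]opprB -!fps_expm1_divP.
move: (col_sum _ _ _ _ _) (row_sum _ _ _ _ _) => T R.
move: (fps_inv_expm1_divP _ v_gt0) (fps_inv_expm1_divP _ w_gt0) (fps_inv_expm1_divP _ u_gt0).
move: (E v) (E w) (E (d * v + a * w)%N) (I v) (I w) (I (d * v + a * w)%N) (e (v + w)%N).
move=> Ev Ew Eu Iv Iw Iu x IEv IEw IEu carlitz.
have {}carlitz : Ew * R = x * Eu - Ev * T.
  apply: (@fps_X_reg F); apply: oppr_inj; apply: (addrI (- (t * Ev) * T)).
  by transitivity (- (t * Ev) * T + - (t * Ew) * R); [|rewrite carlitz]; ring.
transitivity (Iw * Iv * Iu * (Ew * R)).
  by rewrite -[LHS]mul1r -IEw; ring.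
rewrite carlitz.
transitivity (x * Iv * Iw * (Iu * Eu) - T * Iu * Iw * (Iv * Ev)); first by ring.
by rewrite IEu IEv !mulr1.
Qed.

(* The ray through [v + w] cuts off the unimodular cone on [v] and [v + w]. *)
Lemma cone_split d a v w : (0 < d < a)%N -> (0 < v)%N -> (0 < w)%N ->
  cone d a v w = cone d (a - d) (v + w) w + e (v + w)%N * I v * I (v + w)%N.
Proof.
case/andP=> d_gt0 lt_da v_gt0 w_gt0.
have vw_gt0 : (0 < v + w)%N by rewrite addn_gt0 v_gt0.
(* Both cones are quadrants minus the same column sum, which cancels; only the two quadrant terms
   remain to be compared. *)
rewrite !cone_colE ?subn_gt0 //; last exact: ltn_trans lt_da.
have -> : (d * (v + w) + (a - d) * w = d * v + a * w)%N by nia.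
have -> : col_sum _ d (a - d) (e (v + w)%N) (e w) = col_sum _ d a (e v) (e w).
  by rewrite fps_expD col_sum_shear ?d_gt0.
rewrite [X in _ = X]addrAC; congr (_ - _).
have := fps_inv_expm1_divP _ v_gt0; have := fps_inv_expm1_divP _ w_gt0.
have := fps_inv_expm1_divP _ vw_gt0.
have Evw : E (v + w)%N = e w * E v + E w.
  apply: (@fps_X_reg F); rewrite mulrDr mulrCA !fps_expm1_divP fps_expD; ring.
rewrite (fps_expD (v + w)); move: Evw.
move: (I v) (I w) (I (v + w)%N) => a1 a2 a3.
move: (E v) (E w) (E (v + w)%N) (e w) (e (v + w)%N) => b1 b2 b3 y x Evw IEvw IEw IEv.
transitivity (x * (a1 * a2 * (a3 * b3))); first by rewrite IEvw mulr1 mulrA.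
rewrite Evw.
transitivity (x * (y * a3 * a2 * (a1 * b1) + a1 * a3 * (a2 * b2))); first by ring.
by rewrite IEv IEw; ring.
Qed.

(** The side [v] and the ray [d v + a w] do not move: the same cone is written in the bases [(v, w)]
    and [(v, v + w)]. *)
Lemma cone_shear d a v w : (0 < a < d)%N ->
  cone d a v w = cone (d - a) a v (v + w).
Proof.
case/andP=> a_gt0 lt_ad; rewrite /cone fps_expD row_sum_shear ?a_gt0 //.
by have -> : ((d - a) * v + a * (v + w) = d * v + a * w)%N by nia.
Qed.

Lemma cone11 v w :
  cone 1 1 v w = e v * I v * (e (v + w)%N * I (v + w)%N).
Proof. by rewrite /cone /row_sum big_nat1 !mul1n expr1 fps_expD divn1; ring. Qed.

Lemma fps_exp_inv u : (0 < u)%N -> e u * I u = I u + t.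
Proof.
move=> u_gt0; have -> : e u = 1 + t * E u by rewrite fps_expm1_divP addrC subrK.
by rewrite mulrDl mul1r -mulrA [E u * _]mulrC fps_inv_expm1_divP ?mulr1.
Qed.

(** Coefficient [n] of [t / (e^{ut} - 1)] is homogeneous of degree [n - 1] in [u]; taking [u = 1]
    expresses every [I z] by Bernoulli numbers. *)
Lemma fps_inv_expm1_div_scale u z n : (0 < u)%N -> (0 < z)%N ->
  I (u * z)%N n = z%:R ^+ n / z%:R * I u n.
Proof.
move=> u_gt0 z_gt0; have uz_gt0 : (0 < u * z)%N by rewrite muln_gt0 u_gt0.
have z_neq0 : z%:R != 0 :> F by rewrite pnatr_eq0 -lt0n.
pose g : fps F := fun n => z%:R ^+ n / z%:R * I u n.
suff gE : g * E (u * z)%N = 1.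
  have := congr1 (fun h : fps F => h * I (u * z)%N) gE.
  by rewrite mul1r -mulrA [E _ * _]mulrC fps_inv_expm1_divP // mulr1 => <-.
apply/funext => m; transitivity (z%:R ^+ m * (I u * E u) m).
  rewrite !fps_mulE mulr_sumr; apply: eq_bigr => i _.
  have le_im : (i <= m)%N by rewrite -ltnS.
  rewrite /g /fps_expm1_div /fps_exp natrM exprMn [z%:R ^+ _.+1]exprS.
  have -> : z%:R ^+ m = z%:R ^+ i * z%:R ^+ (m - i) :> F by rewrite -exprD subnKC.
  have := fact_neq0 (m - i).+1; move: (I u i) => x f_neq0.
  by field; rewrite z_neq0 f_neq0.
rewrite fps_inv_expm1_divP //; case: m => [|m]; first by rewrite expr0 mul1r.
exact: mulr0.
Qed.

(* The part of degree [K - 2] of [1 / ((exp X - 1) * (exp Y - 1))] *)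
Definition bernoulli_term K (X Y : F) : F :=
  \sum_(i < K.+1) fps_inv (fps_expm1_div 1) i * fps_inv (fps_expm1_div 1) (K - i)%N
    * X ^+ i * Y ^+ (K - i) / (X * Y).

Lemma coef_cone_unimodular K u v : (0 < u)%N -> (0 < v)%N ->
  (I u * I v) K = bernoulli_term K u%:R v%:R.
Proof.
move=> u_gt0 v_gt0; rewrite fps_mulE; apply: eq_bigr => i _.
rewrite -[u]mul1n -[v]mul1n !fps_inv_expm1_div_scale // !mul1n.
rewrite invfM; move: u%:R^-1 v%:R^-1 => x y; ring.
Qed.

End LatticeCones.

(** * Integer matrices of determinant [p] with positive entries *)

Section Quadruples.
Variable p : nat.

(* [((a, b), (c, d))] with [a * b + c * d = p] and positive entries; it stands
   for the basis [v = (a, c)], [w = (- d, b)] of a lattice of index [p]. *)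
Definition quad : Type := ((nat * nat) * (nat * nat))%type.

Definition quads : seq quad :=
  let s := [seq (x, y) | x <- iota 1 p, y <- iota 1 p] in
  [seq M <- [seq (x, y) | x <- s, y <- s] | (M.1.1 * M.1.2 + M.2.1 * M.2.2 == p)%N].

(* [split_quad] replaces the basis [(v, w)] by [(v + w, w)], and [shear_quad]
   replaces it by [(v, v + w)]. *)
Definition split_quad (M : quad) : quad :=
  ((M.1.1 - M.2.2, M.1.2), (M.2.1 + M.1.2, M.2.2))%N.
Definition shear_quad (M : quad) : quad :=
  ((M.1.1, M.1.2 + M.2.1), (M.2.1, M.2.2 - M.1.1))%N.

(** The range [1..p] costs nothing: positive entries with [a b + c d = p] cannot exceed [p]. *)
Lemma mem_quads a b c d : (((a, b), (c, d)) \in quads) =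
  [&& 0 < a, 0 < b, 0 < c, 0 < d & a * b + c * d == p]%N.
Proof.
have memP (T1 T2 : eqType) (s1 : seq T1) (s2 : seq T2) x y :
    ((x, y) \in [seq (x, y) | x <- s1, y <- s2]) = (x \in s1) && (y \in s2).
  by apply/allpairsP/andP => [[[u v] [? ?] [-> ->]]|[? ?]] //; exists (x, y).
by rewrite mem_filter !memP !mem_iota /=; apply/idP/idP; nia.
Qed.

(* The values of [v] and [w] under the linear form [(x, y) |-> x + y * z] *)
Definition quad_vec1 (z : nat) (M : quad) : nat := (M.1.1 + M.2.1 * z)%N.
Definition quad_vec2 (z : nat) (M : quad) : nat := (M.1.2 * z - M.2.2)%N.

(** The bound [d < p <= z] keeps the truncated subtraction in [quad_vec2] exact. *)
Lemma quad_vec_gt0 z M : (p <= z)%N -> M \in quads ->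
  (0 < quad_vec1 z M)%N /\ (0 < quad_vec2 z M)%N.
Proof.
case: M => [[a b] [c d]] le_pz; rewrite mem_quads /quad_vec1 /quad_vec2 /=.
by case/and5P=> ? ? ? ? /eqP pE; split; nia.
Qed.

Lemma quads_uniq : uniq quads.
Proof.
have pairP (T1 T2 : eqType) (s1 : seq T1) (s2 : seq T2) : uniq s1 -> uniq s2 ->
    uniq [seq (x, y) | x <- s1, y <- s2].
  by move=> *; apply: allpairs_uniq => // -[? ?] [? ?].
by apply: filter_uniq; apply/pairP; apply/pairP; apply: iota_uniq.
Qed.

(** The determinant is preserved, since [(a - d) b + (c + b) d = a b + c d], and the inverse
    replaces [(a, c)] by [(a + d, c - b)]. *)
Lemma sum_quads_split (V : zmodType) (U : quad -> V) :
  \sum_(M <- quads | (M.2.2 < M.1.1)%N) U (split_quad M) =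
  \sum_(M <- quads | (M.1.2 < M.2.1)%N) U M.
Proof.
rewrite -big_filter -[RHS]big_filter -(big_map split_quad xpredT).
apply/perm_big/uniq_perm; rewrite ?(filter_uniq _ quads_uniq) //.
  rewrite map_inj_in_uniq ?(filter_uniq _ quads_uniq) //.
  move=> [[a b] [c d]] [[a' b'] [c' d']]; rewrite !(mem_filter _ _ quads) /split_quad /=.
  by case/andP=> ? _ /andP[? _] [] *; congr ((_, _), (_, _)); lia.
move=> [[a b] [c d]]; apply/mapP/idP => [[[[a' b'] [c' d']]]|].
  rewrite !(mem_filter _ _ quads) !mem_quads /split_quad /=.
  by case/andP=> ? ? [-> -> -> ->]; nia.
rewrite (mem_filter _ _ quads) mem_quads /= => H.
exists ((a + d, b), (c - b, d))%N.
  by rewrite (mem_filter _ _ quads) mem_quads /=; nia.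
by rewrite /split_quad /=; congr ((_, _), (_, _)); nia.
Qed.

Lemma sum_quads_shear (V : zmodType) (U : quad -> V) :
  \sum_(M <- quads | (M.1.1 < M.2.2)%N) U (shear_quad M) =
  \sum_(M <- quads | (M.2.1 < M.1.2)%N) U M.
Proof.
rewrite -big_filter -[RHS]big_filter -(big_map shear_quad xpredT).
apply/perm_big/uniq_perm; rewrite ?(filter_uniq _ quads_uniq) //.
  rewrite map_inj_in_uniq ?(filter_uniq _ quads_uniq) //.
  move=> [[a b] [c d]] [[a' b'] [c' d']]; rewrite !(mem_filter _ _ quads) /shear_quad /=.
  by case/andP=> ? _ /andP[? _] [] *; congr ((_, _), (_, _)); lia.
move=> [[a b] [c d]]; apply/mapP/idP => [[[[a' b'] [c' d']]]|].
  rewrite !(mem_filter _ _ quads) !mem_quads /shear_quad /=.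
  by case/andP=> ? ? [-> -> -> ->]; nia.
rewrite (mem_filter _ _ quads) mem_quads /= => H.
exists ((a, b - c), (c, d + a))%N.
  by rewrite (mem_filter _ _ quads) mem_quads /=; nia.
by rewrite /shear_quad /=; congr ((_, _), (_, _)); nia.
Qed.

Lemma sum_quads_swap (V : zmodType) (U : quad -> V) :
  \sum_(M <- quads) U ((M.2.2, M.2.1), (M.1.2, M.1.1)) = \sum_(M <- quads) U M.
Proof.
rewrite -(big_map (fun M : quad => ((M.2.2, M.2.1), (M.1.2, M.1.1))) xpredT).
apply/perm_big/uniq_perm; rewrite ?quads_uniq //.
  by rewrite map_inj_uniq ?quads_uniq // => -[[? ?] [? ?]] [[? ?] [? ?]] [-> -> -> ->].
move=> [[a b] [c d]]; apply/mapP/idP => [[[[a' b'] [c' d']]]|].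
  rewrite !mem_quads => /and5P[? ? ? ? /eqP <-] [-> -> -> ->].
  by apply/and5P; split=> //; apply/eqP; ring.
move=> H; exists ((d, c), (b, a)) => //; move: H.
rewrite !mem_quads => /and5P[? ? ? ? /eqP <-].
by apply/and5P; split=> //; apply/eqP; ring.
Qed.

Lemma sum_quads_trichotomy (V : zmodType) (f g : quad -> nat) (U : quad -> V) :
  \sum_(M <- quads) U M =
  \sum_(M <- quads | (f M < g M)%N) U M + \sum_(M <- quads | (g M < f M)%N) U M
  + \sum_(M <- quads | f M == g M) U M.
Proof.
rewrite (bigID (fun M => f M < g M)%N) /= -addrA; congr (_ + _).
rewrite (bigID (fun M => g M < f M)%N) /=.
congr (_ + _); apply: eq_bigl => M; lia.
Qed.

Hypothesis p_prime : prime p.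

Let divp x y z : (x * (y + z) = p)%N -> (0 < y)%N -> (0 < z)%N -> (x == 1)%N.
Proof.
move=> xyz y_gt0 z_gt0; have := dvdn_mulr (y + z) (dvdnn x); rewrite xyz.
case/primeP: p_prime => p_gt1 h /h /orP[//|/eqP xp]; exfalso.
  by move: xyz; rewrite xp; nia.
Qed.

(** These are the ends of the paths: [a = d] gives [a (b + c) = p], and primality forces [a = 1]. *)
Lemma sum_quads_last (V : zmodType) (U : quad -> V) :
  \sum_(M <- quads | M.1.1 == M.2.2) U M =
  \sum_(1 <= b < p) U ((1, b), (p - b, 1))%N.
Proof.
rewrite -big_filter -(big_map (fun b => ((1, b), (p - b, 1))%N) xpredT).
apply/perm_big/uniq_perm; rewrite ?(filter_uniq _ quads_uniq) //.
  by rewrite map_inj_uniq ?iota_uniq // => ? ? [].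
move=> [[a b] [c d]]; rewrite (mem_filter _ _ quads) mem_quads /=; apply/idP/mapP.
  case/andP=> /eqP <- /and5P[a_gt0 b_gt0 c_gt0 _ /eqP pE].
  have /eqP a1 := divp a b c ltac:(nia) b_gt0 c_gt0; exists b.
    by rewrite mem_index_iota; nia.
  by congr ((_, _), (_, _)); nia.
by case=> b'; rewrite mem_index_iota => ? [-> -> -> ->]; lia.
Qed.

(** These are the starts of the paths: [b = c] gives [b (a + d) = p], hence [b = 1]. *)
Lemma sum_quads_first (V : zmodType) (U : quad -> V) :
  \sum_(M <- quads | M.1.2 == M.2.1) U M =
  \sum_(1 <= d < p) U ((p - d, 1), (1, d))%N.
Proof.
rewrite -big_filter -(big_map (fun d => ((p - d, 1), (1, d))%N) xpredT).
apply/perm_big/uniq_perm; rewrite ?(filter_uniq _ quads_uniq) //.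
  by rewrite map_inj_uniq ?iota_uniq // => ? ? [].
move=> [[a b] [c d]]; rewrite (mem_filter _ _ quads) mem_quads /=; apply/idP/mapP.
  case/andP=> /eqP <- /and5P[a_gt0 b_gt0 _ d_gt0 /eqP pE].
  have /eqP b1 := divp b a d ltac:(nia) a_gt0 d_gt0; exists d.
    by rewrite mem_index_iota; nia.
  by congr ((_, _), (_, _)); nia.
by case=> d'; rewrite mem_index_iota => ? [-> -> -> ->]; lia.
Qed.

(** The total of [U] is decomposed twice: by comparing [a] with [d], which decides the step out of a
    basis, and by comparing [b] with [c], which decides the step into it. *)
Lemma sum_quads_telescope (V : zmodType) (U : quad -> V) :
  \sum_(M <- quads | (M.2.2 < M.1.1)%N) (U M - U (split_quad M))
  + \sum_(M <- quads | (M.1.1 < M.2.2)%N) (U M - U (shear_quad M))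
  + \sum_(1 <= b < p) U ((1, b), (p - b, 1))%N =
  \sum_(1 <= d < p) U ((p - d, 1), (1, d))%N.
Proof.
rewrite !sumrB sum_quads_split sum_quads_shear -sum_quads_last -sum_quads_first.
have := sum_quads_trichotomy _ (fun M => M.2.2) (fun M => M.1.1) U.
rewrite (sum_quads_trichotomy _ (fun M => M.1.2) (fun M => M.2.1) U) /=.
under [\sum_(M <- quads | M.2.2 == M.1.1) _]eq_bigl do rewrite eq_sym.
move: (\sum_(M <- _ | _) _) (\sum_(M <- _ | _) _) (\sum_(M <- _ | _) _).
move: (\sum_(M <- _ | _) _) (\sum_(M <- _ | _) _) (\sum_(M <- _ | _) _).
move=> x1 x2 x3 x4 x5 x6 H.
rewrite [x3 - x6 + _]addrACA -opprD [LHS]addrAC -H.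
by rewrite [LHS]addrAC subrr add0r.
Qed.
End Quadruples.

(** * Character sums *)

Section CharacterSums.
Variables (C : numClosedFieldType) (p : nat) (chi : int -> C).
Hypotheses (p_prime : prime p) (chi_char : dirichlet_character p chi).

Lemma character1 : chi 1 = 1.
Proof.
case: chi_char => _ _ chiM chi_neq0.
have chi1_neq0 : chi 1 != 0 by rewrite chi_neq0 coprimezE coprime1n.
by apply: (mulfI chi1_neq0); rewrite mulr1 -chiM mulr1.
Qed.

Lemma characterX (n k : nat) : chi (n ^ k)%N%:Z = chi n%:Z ^+ k.
Proof.
case: chi_char => _ _ chiM _; elim: k => [|k IHk]; first exact: character1.
by rewrite expnS PoszM exprS chiM IHk.
Qed.

Lemma character_addMn a n : chi (a + (p * n)%N%:Z) = chi a.
Proof.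
case: chi_char => _ chi_per _ _; elim: n => [|n IHn]; first by rewrite muln0 addr0.
by rewrite mulnS addnC PoszD addrA chi_per.
Qed.

Lemma character_modn n : chi (n %% p)%N%:Z = chi n%:Z.
Proof.
rewrite [in RHS](divn_eq n p) addnC PoszD mulnC; exact/esym/character_addMn.
Qed.

Lemma character_subn n : (n <= p)%N -> chi (p - n)%N%:Z = chi (- 1) * chi n%:Z.
Proof.
case: chi_char => _ chi_per chiM _ le_np.
by rewrite -subzn // addrC chi_per -[- n%:Z]mulN1r chiM.
Qed.

Lemma character_dvd n : (p %| n)%N -> chi n%:Z = 0.
Proof.
case: chi_char => _ _ _ chi_neq0 p_n; apply/eqP; move: (chi_neq0 n%:Z).
by rewrite coprimezE !absz_nat coprime_sym prime_coprime // p_n => /negbFE.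
Qed.

(** By Fermat's little theorem [chi n] is a root of unity of order dividing [p - 1], hence of
    modulus 1. *)
Lemma character_conjV n : ~~ (p %| n)%N -> (chi n%:Z)^* * chi n%:Z = 1.
Proof.
move=> p_n; case: chi_char => _ _ _ chi_neq0.
have chin_neq0 : chi n%:Z != 0.
  by rewrite chi_neq0 coprimezE !absz_nat coprime_sym prime_coprime.
have : chi n%:Z ^+ p.-1 = 1.
  apply: (mulfI chin_neq0); rewrite mulr1 -exprS prednK ?prime_gt0 //.
  by rewrite -characterX -character_modn fermat_little // character_modn.
move/(congr1 Num.norm)/eqP; rewrite normrX normr1 pexpr_eq1 ?normr_ge0 //.
  by move/eqP=> chi_n; rewrite mulrC -normCK chi_n expr1n.
by have := prime_gt1 p_prime; lia.
Qed.

(** Multiplication by [n] permutes the nonzero residues, and [chi d = conj(chi n) chi(n d)]. *)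
Lemma sum_character_dilate n (Phi : nat -> C) : ~~ (p %| n)%N ->
  \sum_(1 <= d < p) chi d%:Z * Phi (n * d %% p)%N =
  (chi n%:Z)^* * \sum_(1 <= x < p) chi x%:Z * Phi x.
Proof.
move=> p_n; case: (chi_char) => _ _ chiM _; rewrite mulr_sumr.
have co_pn : coprime p n by rewrite prime_coprime.
pose s := [seq (n * d %% p)%N | d <- index_iota 1 p].
have s_sub : {subset s <= index_iota 1 p}.
  move=> x /mapP[d]; rewrite !mem_index_iota => /andP[d_gt0 lt_dp] ->.
  rewrite ltn_mod (prime_gt0 p_prime) andbT lt0n -/(_ %| _)%N Gauss_dvdr //.
  by apply: contraTN lt_dp => /(dvdn_leq d_gt0); rewrite leqNgt.
have s_uniq : uniq s.
  rewrite map_inj_in_uniq ?iota_uniq // => x y; rewrite !mem_index_iota.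
  wlog le_xy : x y / (x <= y)%N => [IH|] ltx lty.
    by case/orP: (leq_total x y) => ? ?; [|symmetry]; apply: IH.
  move/eqP; rewrite eq_sym eqn_mod_dvd ?leq_mul2l ?le_xy ?orbT // -mulnBr Gauss_dvdr //.
  by rewrite -eqn_mod_dvd // !modn_small; [move/eqP|case/andP: ltx|case/andP: lty].
have s_perm : perm_eq s (index_iota 1 p).
  apply: uniq_perm; rewrite ?iota_uniq //.
  by have [] := uniq_min_size s_uniq s_sub; rewrite ?size_map.
rewrite -[RHS](perm_big _ s_perm) /=.
rewrite big_map; apply: eq_bigr => d _.
by rewrite character_modn PoszM chiM !mulrA character_conjV // mul1r.
Qed.

Lemma sum_character_opp (Phi : nat -> C) :
  \sum_(1 <= d < p) chi d%:Z * Phi (p - d)%N =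
  chi (- 1) * \sum_(1 <= x < p) chi x%:Z * Phi x.
Proof.
rewrite big_nat_rev mulr_sumr; apply: eq_big_nat => d /andP[d_gt0 lt_dp] /=.
have -> : (1 + p - d.+1)%N = (p - d)%N by lia.
by rewrite subKn 1?ltnW // character_subn 1?ltnW // mulrA.
Qed.

Lemma sum_character0 n : chi n%:Z != 1 -> ~~ (p %| n)%N ->
  \sum_(1 <= x < p) chi x%:Z = 0.
Proof.
move=> chi_n p_n; have := sum_character_dilate n (fun=> 1) p_n.
rewrite /= -!mulr_suml !mulr1.
move/(congr1 (fun x => chi n%:Z * x)); rewrite mulrA [chi n * _^*]mulrC character_conjV // mul1r.
by move/eqP; rewrite -subr_eq0 -[X in _ - X]mul1r -mulrBl mulf_eq0 subr_eq0 (negPf chi_n) => /eqP.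
Qed.
End CharacterSums.

(** * Dedekind sums and the telescoping relation *)

Section DedekindSum.
Variables (C : numClosedFieldType) (p : nat) (chi : int -> C).
Hypotheses (p_prime : prime p) (chi_char : dirichlet_character p chi).
Hypothesis chi_sum0 : \sum_(1 <= x < p) chi x%:Z = 0.

Local Notation e u := (fps_exp (u%:R : C) : fps C).
Local Notation I u := (fps_inv (fps_expm1_div (u%:R : C)) : fps C).

(* Constant on the bases of a given lattice, by [quad_weight_shear] *)
Definition quad_weight (M : quad) : C := (chi M.1.2%:Z)^* * chi M.2.2%:Z.

(** The residue of [d / b] modulo [p] is unchanged because [(d - a) b + p = d (b + c)]. *)
Lemma quad_weight_shear M : M \in quads p -> (M.1.1 < M.2.2)%N ->
  quad_weight (shear_quad M) = quad_weight M.
Proof.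
case: M => [[a b] [c d]]; rewrite mem_quads /quad_weight /= => /and5P[? ? ? ? /eqP pE] lt_ad.
case: chi_char => _ chi_per chiM _.
have p_b : ~~ (p %| b)%N by rewrite gtnNdvd //; nia.
have p_bc : ~~ (p %| b + c)%N by rewrite gtnNdvd //; nia.
have chiE : chi (d - a)%N%:Z * chi b%:Z = chi d%:Z * chi (b + c)%N%:Z.
  rewrite -!chiM -!PoszM -[LHS]chi_per -PoszD; congr (chi _%:Z); nia.
rewrite -[LHS]mul1r -(character_conjV _ _ _ p_prime chi_char _ p_b).
transitivity ((chi b)^* * (chi (b + c)%N)^* * (chi (d - a)%N%:Z * chi b%:Z)); first by ring.
rewrite chiE -[RHS]mul1r -(character_conjV _ _ _ p_prime chi_char _ p_bc); ring.
Qed.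

(** To the basis [(v, w)] is attached the cone on [v] and [d v + a w = (0, p)], whose second side
    never moves. A shear keeps this cone by [cone_shear]; a split removes the unimodular cone on [v]
    and [v + w] by [cone_split]. *)
Lemma weighted_cone_telescope z K : (p <= z)%N ->
  \sum_(M <- quads p | (M.2.2 < M.1.1)%N) quad_weight M *
     ((e (quad_vec1 z M + quad_vec2 z M)%N * I (quad_vec1 z M)
       * I (quad_vec1 z M + quad_vec2 z M)%N) K)
  + \sum_(1 <= b < p) (chi b%:Z)^* * cone C 1 1 (1 + (p - b) * z)%N (b * z - 1)%N K =
  \sum_(1 <= d < p) chi d%:Z * cone C d (p - d) (p - d + z)%N (z - d)%N K.
Proof.
move=> le_pz.
pose U M := quad_weight M * cone C M.2.2 M.1.1 (quad_vec1 z M) (quad_vec2 z M) K.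
transitivity (\sum_(1 <= d < p) U ((p - d, 1), (1, d))%N); last first.
  apply: eq_bigr => d _; rewrite /U /quad_weight /quad_vec1 /quad_vec2 /=.
  by rewrite (character1 _ _ _ chi_char) rmorph1 !mul1r !mul1n.
rewrite -(sum_quads_telescope _ p_prime).
rewrite [X in _ = _ + X + _]big_seq_cond [X in _ = _ + X + _]big1 ?addr0; last first.
  move=> [[a b] [c d]] /andP[M_in /= lt_ad]; apply/eqP; rewrite subr_eq0; apply/eqP.
  rewrite /U (quad_weight_shear _ M_in lt_ad) /=; congr (_ * _).
  have [v_gt0 w_gt0] := quad_vec_gt0 _ _ _ le_pz M_in.
  move: M_in; rewrite mem_quads => /and5P[a_gt0 _ _ _ _].
  rewrite cone_shear ?a_gt0 //; congr (cone _ _ _ _ _ _); move: w_gt0.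
  by rewrite /quad_vec1 /quad_vec2 /=; nia.
congr (_ + _); last first.
  apply: eq_bigr => b _; rewrite /U /quad_weight /quad_vec1 /quad_vec2 /=.
  by rewrite (character1 _ _ _ chi_char) mulr1.
rewrite big_seq_cond [RHS]big_seq_cond; apply: eq_bigr => -[[a b] [c d]] /andP[M_in /= lt_da].
have [v_gt0 w_gt0] := quad_vec_gt0 _ _ _ le_pz M_in.
rewrite /U -[quad_weight (split_quad _)]/(quad_weight ((a, b), (c, d))) -mulrBr; congr (_ * _).
have d_gt0 : (0 < d)%N by move: M_in; rewrite mem_quads => /and5P[].
rewrite /= (cone_split _ d a) ?d_gt0 // fps_addE.
have -> : quad_vec1 z (split_quad ((a, b), (c, d))) =
    (quad_vec1 z ((a, b), (c, d)) + quad_vec2 z ((a, b), (c, d)))%N.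
  by move: w_gt0; rewrite /quad_vec1 /quad_vec2 /=; nia.
by rewrite addrAC subrr add0r.
Qed.

(** Each of these cones is the first quadrant, spanned by [(p, 0)] and [(0, p)], for the lattice
    with basis [(p, 0)], [(- d, 1)]. The substitution [x = - n d] in row [n] separates the character
    sum into a sum over [x] and a sum over [n]. *)
Lemma sum_initial_cones z K : (p <= z)%N ->
  \sum_(1 <= d < p) chi d%:Z * cone C d p p (z - d)%N K =
  chi (- 1) * \sum_(i < K.+1)
    gen_bernoulli p chi i / i`!%:R
    * (gen_bernoulli p (conj_character chi) (K - i)%N / (K - i)`!%:R
       * z%:R ^+ (K - i) / z%:R).
Proof.
move=> le_pz; have p_gt0 := prime_gt0 p_prime; have z_gt0 := leq_trans p_gt0 le_pz.
(* The first lattice point of row [n] to the right of the axis has [x = p - (n d mod p)]. *)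
have rowE d : (1 <= d < p)%N -> cone C d p p (z - d)%N =
   \sum_(1 <= n < p.+1) e (n * z)%N * (e (p - (n * d) %% p)%N * I p * I (p * z)%N).
  case/andP=> d_gt0 lt_dp; rewrite /cone /row_sum !mulr_suml.
  have -> : (d * p + p * (z - d) = p * z)%N by nia.
  apply: eq_bigr => n _; rewrite !fps_expX -fps_expD !mulrA -fps_expD.
  congr (e _ * _ * _).
  have := divn_eq (n * d) p; have := ltn_pmod (n * d) p_gt0; nia.
have genE psi i : gen_bernoulli p psi i / i`!%:R =
    \sum_(1 <= a < p.+1) psi a%:Z * (e a * I p) i.
  rewrite /gen_bernoulli mulrAC divff ?mul1r ?pnatr_eq0 -?lt0n ?fact_gt0 //.
  rewrite /fps_mul; under eq_bigr do rewrite mulr_suml.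
  rewrite exchange_big /=; apply: eq_bigr => a _; rewrite fps_mulE mulr_sumr.
  by apply: eq_bigr => j _; rewrite -mulrA.
have genzE j : gen_bernoulli p (conj_character chi) j / j`!%:R * z%:R ^+ j / z%:R =
    \sum_(1 <= a < p.+1) (chi a%:Z)^* * (e (a * z)%N * I (p * z)%N) j.
  rewrite genE !mulr_suml; apply: eq_bigr => a _; rewrite /conj_character -!mulrA.
  congr (_ * _); rewrite !fps_mulE mulr_suml; apply: eq_bigr => i _.
  have le_ij : (i <= j)%N by rewrite -ltnS.
  rewrite fps_inv_expm1_div_scale // /fps_exp natrM exprMn.
  have -> : z%:R ^+ j = z%:R ^+ i * z%:R ^+ (j - i) :> C by rewrite -exprD subnKC.
  by rewrite !mulrA; ring.
under [X in _ = _ * X]eq_bigr do rewrite genzE genE.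
rewrite big_nat; under eq_bigr => d Hd do rewrite rowE // fps_sumE mulr_sumr.
rewrite -big_nat exchange_big /=.
have innerE n : (1 <= n < p.+1)%N ->
    \sum_(1 <= d < p) chi d%:Z *
      (e (n * z)%N * (e (p - n * d %% p)%N * I p * I (p * z)%N)) K =
    chi (- 1) * ((chi n%:Z)^* * \sum_(1 <= x < p) chi x%:Z *
      (e (n * z)%N * (e x * I p * I (p * z)%N)) K).
  case/andP=> n_gt0; rewrite ltnS leq_eqVlt => /orP[/eqP ->|lt_np].
    (* For [n = p] the exponential no longer depends on [d], so the left side vanishes by
       [chi_sum0]. *)
    rewrite (character_dvd _ _ _ p_prime chi_char) ?dvdnn // rmorph0 mul0r mulr0.
    under eq_bigr do rewrite modnMr subn0.
    by rewrite -mulr_suml chi_sum0 mul0r.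
  have p_n : ~~ (p %| n)%N by rewrite gtnNdvd.
  rewrite (sum_character_dilate _ _ _ p_prime chi_char _
    (fun m => (e (n * z)%N * (e (p - m)%N * I p * I (p * z)%N)) K) p_n).
  by rewrite (sum_character_opp _ _ _ p_prime chi_char
    (fun m => (e (n * z)%N * (e m * I p * I (p * z)%N)) K)) mulrCA.
rewrite big_nat; under eq_bigr => n Hn do rewrite innerE //.
rewrite -big_nat -mulr_sumr; congr (_ * _).
under [RHS]eq_bigr do rewrite mulr_sumr.
rewrite exchange_big /=; apply: eq_bigr => n _.
under [RHS]eq_bigr do rewrite mulrCA.
rewrite -mulr_sumr; congr (_ * _).
under [RHS]eq_bigr do rewrite mulr_suml.
rewrite exchange_big /= big_nat_recr ?prime_gt0 //= [X in _ = _ + X]big1 ?addr0.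
  apply: eq_bigr => x _.
  rewrite (mulrCA (e (n * z)%N)) fps_mulE mulr_sumr.
  by apply: eq_bigr => i _; rewrite mulrA.
by move=> i _; rewrite (character_dvd _ _ _ p_prime chi_char) ?dvdnn // !mul0r.
Qed.
(** This is coefficient [K + 1] of [weighted_cone_telescope], with the starting cones cut out of the
    quadrants of [sum_initial_cones] by [cone_split]. The corrections from [e^{ut} / (e^{ut} - 1) =
    1 / (e^{ut} - 1) + 1] vanish because coefficient [K] of the Bernoulli series is zero and
    [1 < K]. *)
Lemma dedekind_sum z K : (p <= z)%N -> (1 < K)%N ->
  fps_inv (fps_expm1_div 1) K = 0 :> C ->
  \sum_(M <- quads p | (M.2.2 < M.1.1)%N) quad_weight M *
     bernoulli_term C K.+1 (quad_vec1 z M)%:R (quad_vec1 z M + quad_vec2 z M)%:R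
  + \sum_(1 <= b < p) (chi b%:Z)^* *
     bernoulli_term C K.+1 (1 + (p - b) * z)%:R (p * z)%:R =
  chi (- 1) * \sum_(i < K.+2)
    gen_bernoulli p chi i / i`!%:R
    * (gen_bernoulli p (conj_character chi) (K.+1 - i)%N / (K.+1 - i)`!%:R
       * z%:R ^+ (K.+1 - i) / z%:R)
  - \sum_(1 <= d < p) chi d%:Z * bernoulli_term C K.+1 p%:R (p - d + z)%:R.
Proof.
move=> le_pz K_gt1 betaK; have p_gt0 := prime_gt0 p_prime.
have IK u : (0 < u)%N -> I u K = 0.
  by move=> u_gt0; rewrite -[u]mul1n fps_inv_expm1_div_scale // betaK mulr0.
have coneK u v : (0 < u)%N -> (0 < v)%N ->
    (e v * I u * I v) K.+1 = bernoulli_term C K.+1 u%:R v%:R.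
  move=> u_gt0 v_gt0; rewrite mulrAC fps_exp_inv // mulrDl fps_addE fps_XM IK //.
  by rewrite addr0 mulrC coef_cone_unimodular.
rewrite -sum_initial_cones //.
transitivity (\sum_(1 <= d < p) chi d%:Z * cone C d (p - d) (p - d + z)%N (z - d)%N K.+1);
  last first.
  rewrite -sumrB; apply: eq_big_nat => d /andP[d_gt0 lt_dp].
  have zd_gt0 : (0 < z - d)%N by rewrite subn_gt0; apply: leq_trans le_pz.
  rewrite [in RHS]cone_split ?d_gt0 // fps_addE.
  have -> : (p + (z - d) = p - d + z)%N by lia.
  by rewrite coneK ?addn_gt0 ?subn_gt0 ?lt_dp // mulrDr addrK.
rewrite -weighted_cone_telescope //; congr (_ + _).
  rewrite big_seq_cond [RHS]big_seq_cond; apply: eq_bigr => M /andP[M_in _].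
  have [v_gt0 w_gt0] := quad_vec_gt0 _ _ _ le_pz M_in.
  by rewrite coneK // addn_gt0 v_gt0.
apply: eq_big_nat => b /andP[b_gt0 lt_bp]; congr (_ * _); rewrite cone11.
have z_gt0 := leq_trans p_gt0 le_pz.
have -> : (1 + (p - b) * z + (b * z - 1) = p * z)%N by nia.
rewrite !fps_exp_inv ?muln_gt0 ?p_gt0 //.
rewrite mulrDl !mulrDr !fps_addE coef_cone_unimodular ?muln_gt0 ?p_gt0 //.
rewrite [I _ * fps_X C]mulrC !fps_XM !IK ?muln_gt0 ?p_gt0 // !addr0.
by case: (K) K_gt1 => [|[|n]] // _; rewrite add0r [LHS](esym (addr0 _)).
Qed.
End DedekindSum.

(** * Telescoping a period function along the paths *)

Section EisensteinRelation.
Variables (C : numClosedFieldType) (p : nat) (chi : int -> C).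
Hypotheses (p_prime : prime p) (chi_char : dirichlet_character p chi).
Hypothesis chi_sum0 : \sum_(1 <= x < p) chi x%:Z = 0.
Variables (K : nat) (H : C -> C -> C) (c : C).
Hypotheses (K_gt1 : (1 < K)%N) (betaK : fps_inv (fps_expm1_div 1) K = 0 :> C).
Hypothesis H_split : forall X Y : C, X != 0 -> X + Y != 0 ->
  X ^+ K.-1 - Y ^+ K.-1 = H X Y - H (X + Y) Y + c * bernoulli_term C K.+1 X (X + Y).
Hypothesis H_shear : forall X Y : C, X != 0 ->
  X ^+ K.-1 - Y ^+ K.-1 = H X Y - H X (X + Y).

(** [H_split] is applied at the bases with [d < a] and at the ends of the paths, [H_shear] at those
    with [a < d]; the [bernoulli_term] sums are then evaluated by [dedekind_sum]. *)
Lemma period_sum z : (p <= z)%N ->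
  \sum_(M <- quads p) quad_weight C chi M *
     ((quad_vec1 z M)%:R ^+ K.-1 - (quad_vec2 z M)%:R ^+ K.-1) =
  \sum_(1 <= d < p) chi d%:Z * H p%:R (p - d + z)%:R
  - \sum_(1 <= b < p) (chi b%:Z)^* * H (p * z)%:R (b * z - 1)%:R
  + c * (chi (- 1) * \sum_(i < K.+2)
    gen_bernoulli p chi i / i`!%:R
    * (gen_bernoulli p (conj_character chi) (K.+1 - i)%N / (K.+1 - i)`!%:R
       * z%:R ^+ (K.+1 - i) / z%:R)).
Proof.
move=> le_pz; have p_gt0 := prime_gt0 p_prime.
have z_gt0 := leq_trans p_gt0 le_pz.
have nat_neq0 n : (0 < n)%N -> n%:R != 0 :> C by rewrite pnatr_eq0 lt0n.
pose U M := quad_weight C chi M * H (quad_vec1 z M)%:R (quad_vec2 z M)%:R.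
pose D M := bernoulli_term C K.+1 (quad_vec1 z M)%:R (quad_vec1 z M + quad_vec2 z M)%:R.
rewrite (sum_quads_trichotomy _ _ (fun M => M.2.2) (fun M => M.1.1)) /=.
under [\sum_(M <- _ | M.2.2 == M.1.1) _]eq_bigl do rewrite eq_sym.
rewrite (sum_quads_last _ p_prime) /=.
have -> : \sum_(M <- quads p | (M.2.2 < M.1.1)%N) quad_weight C chi M *
     ((quad_vec1 z M)%:R ^+ K.-1 - (quad_vec2 z M)%:R ^+ K.-1) =
   \sum_(M <- quads p | (M.2.2 < M.1.1)%N) (U M - U (split_quad M))
   + c * \sum_(M <- quads p | (M.2.2 < M.1.1)%N) quad_weight C chi M * D M.
  rewrite mulr_sumr -big_split /= big_seq_cond [RHS]big_seq_cond.
  apply: eq_bigr => -[[a b] [c' d]] /andP[M_in /= lt_da].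
  have [v_gt0 w_gt0] := quad_vec_gt0 _ _ _ le_pz M_in.
  have vw_gt0 := ltn_addr (quad_vec2 z ((a, b), (c', d))) v_gt0.
  rewrite H_split -?natrD ?nat_neq0 // /U /D.
  have -> : quad_vec1 z (split_quad ((a, b), (c', d))) =
      (quad_vec1 z ((a, b), (c', d)) + quad_vec2 z ((a, b), (c', d)))%N.
    by move: w_gt0; rewrite /quad_vec1 /quad_vec2 /=; nia.
  rewrite -[quad_weight _ _ (split_quad _)]/(quad_weight C chi ((a, b), (c', d))).
  by rewrite -[quad_vec2 z (split_quad _)]/(quad_vec2 z ((a, b), (c', d))); ring.
have -> : \sum_(M <- quads p | (M.1.1 < M.2.2)%N) quad_weight C chi M *
     ((quad_vec1 z M)%:R ^+ K.-1 - (quad_vec2 z M)%:R ^+ K.-1) =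
   \sum_(M <- quads p | (M.1.1 < M.2.2)%N) (U M - U (shear_quad M)).
  rewrite big_seq_cond [RHS]big_seq_cond.
  apply: eq_bigr => -[[a b] [c' d]] /andP[M_in /= lt_ad].
  have [v_gt0 w_gt0] := quad_vec_gt0 _ _ _ le_pz M_in.
  rewrite /U (quad_weight_shear _ _ _ p_prime chi_char _ M_in lt_ad) -mulrBr; congr (_ * _).
  rewrite H_shear ?nat_neq0 // -natrD.
  congr (_ - H _ _%:R); move: w_gt0; rewrite /quad_vec1 /quad_vec2 /=; nia.
(* The last bases are split once more, which brings in the vector [v + w] of value [p z]. *)
have -> : \sum_(1 <= b < p) quad_weight C chi ((1, b), (p - b, 1))%N *
     ((quad_vec1 z ((1, b), (p - b, 1))%N)%:R ^+ K.-1
      - (quad_vec2 z ((1, b), (p - b, 1))%N)%:R ^+ K.-1) =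
   \sum_(1 <= b < p) U ((1, b), (p - b, 1))%N
   - \sum_(1 <= b < p) (chi b%:Z)^* * H (p * z)%:R (b * z - 1)%:R
   + c * \sum_(1 <= b < p) (chi b%:Z)^* *
     bernoulli_term C K.+1 (1 + (p - b) * z)%:R (p * z)%:R.
  rewrite mulr_sumr -sumrB -big_split /=; apply: eq_big_nat => b /andP[b_gt0 lt_bp].
  rewrite /U /quad_weight /quad_vec1 /quad_vec2 /= (character1 _ _ _ chi_char) mulr1.
  have zE : (1 + (p - b) * z + (b * z - 1) = p * z)%N by nia.
  rewrite H_split -?natrD ?nat_neq0 ?zE ?muln_gt0 ?p_gt0 //; ring.
have dedekind := dedekind_sum _ _ _ p_prime chi_char chi_sum0 _ _ le_pz K_gt1 betaK.
have -> : \sum_(1 <= d < p) chi d%:Z * H p%:R (p - d + z)%:R =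
    \sum_(1 <= d < p) U ((p - d, 1), (1, d))%N
    - c * \sum_(1 <= d < p) chi d%:Z * bernoulli_term C K.+1 p%:R (p - d + z)%:R.
  rewrite mulr_sumr -sumrB; apply: eq_big_nat => d /andP[d_gt0 lt_dp].
  rewrite /U /quad_weight /quad_vec1 /quad_vec2 /= (character1 _ _ _ chi_char).
  rewrite rmorph1 mul1r !mul1n mulrCA -mulrBr; congr (_ * _).
  have zE : (p - d + z = p + (z - d))%N by lia.
  (* With [X = p] and [Y = z - d], the two relations combine to express [H X (X + Y)] as
     [H (X + Y) Y] minus [c] times the [bernoulli_term]. *)
  have := H_split p%:R (z - d)%:R; have := H_shear p%:R (z - d)%:R.
  rewrite -!natrD -zE !nat_neq0 //; last by lia.
  move=> -> // /(_ isT isT) eq_H; apply: oppr_inj; apply: (addrI (H p%:R (z - d)%:R)).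
  by rewrite eq_H; ring.
rewrite -(sum_quads_telescope _ p_prime).
rewrite /D (canRL (addrK _) dedekind).
move: (\sum_(M <- _ | _) _) (\sum_(M <- _ | _) _) => SL SR.
by ring.
Qed.
End EisensteinRelation.

(** * Extracting one coefficient in [z] *)

Lemma coef_affine_exp (R : comNzRingType) (a b : R) m i :
  ((a%:P + b *: 'X) ^+ m)`_i = 'C(m, i)%:R * (a ^+ (m - i) * b ^+ i).
Proof.
rewrite exprDn coef_sum.
have coefE (j : 'I_m.+1) : (a%:P ^+ (m - j) * (b *: 'X) ^+ j *+ 'C(m, j))`_i =
    if i == j then 'C(m, i)%:R * (a ^+ (m - i) * b ^+ i) else 0.
  rewrite coefMn exprZn -rmorphXn /= mul_polyC !coefZ coefXn.
  by case: eqP => [->|_]; rewrite ?mulr0 ?mul0rn // mulr1 mulr_natl.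
under eq_bigr do rewrite coefE.
rewrite -big_mkcond /=; have [lt_im|lt_mi] := ltnP i m.+1.
  by rewrite (big_pred1 (Ordinal lt_im)) // => j; rewrite eq_sym.
rewrite bin_small // mul0r big_pred0 // => j.
by apply/eqP => ij; have := ltn_ord j; rewrite -ij ltnNge lt_mi.
Qed.

Lemma eq_poly_nat (R : numFieldType) (P Q : {poly R}) p :
  (forall z : nat, (p <= z)%N -> P.[z%:R] = Q.[z%:R]) -> P = Q.
Proof.
move=> PQ; apply/eqP; rewrite -subr_eq0; apply/eqP.
pose rs := [seq (p + i)%:R : R | i <- iota 0 (size (P - Q))].
apply: (@roots_geq_poly_eq0 _ _ rs); last by rewrite size_map size_iota.
  apply/allP => _ /mapP[i _ ->]; rewrite /root hornerD hornerN PQ ?leq_addr //.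
  by rewrite subrr.
rewrite map_inj_uniq ?iota_uniq // => i j /eqP.
by rewrite eqr_nat eqn_add2l => /eqP.
Qed.

Section ConvolutionSum.
Variables (C : numClosedFieldType) (p : nat) (chi : int -> C).
Hypotheses (p_prime : prime p) (chi_char : dirichlet_character p chi).
Hypothesis chi_sum0 : \sum_(1 <= x < p) chi x%:Z = 0.

Local Notation beta := (fps_inv (fps_expm1_div (1 : C))).

Let fact_neq0 n : n`!%:R != 0 :> C.
Proof. by rewrite pnatr_eq0 -lt0n fact_gt0. Qed.

Lemma gen_bernoulli_powersum (psi : int -> C) k : psi p%:Z = 0 ->
  gen_bernoulli p psi k / k`!%:R =
  \sum_(j < k.+1) beta j * p%:R ^+ j / p%:R / (k - j)`!%:R *
    \sum_(1 <= x < p) psi x%:Z * x%:R ^+ (k - j).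
Proof.
move=> psi_p; have p_gt0 := prime_gt0 p_prime.
rewrite /gen_bernoulli mulrAC divff ?fact_neq0 // mul1r /fps_mul.
rewrite (reindex_inj rev_ord_inj) /=; apply: eq_bigr => j _.
rewrite subSS subKn; last by rewrite -ltnS.
rewrite big_nat_recr //= psi_p mul0r addr0 -{2}[p]mul1n fps_inv_expm1_div_scale // mulrC.
rewrite !mulr_sumr; apply: eq_bigr => x _; rewrite /fps_exp; ring.
Qed.

(** From [a b = p - c d] follows [chi a chi b = chi(-1) chi c chi d], so reversing the four entries
    multiplies the weight by [chi(-1)]. *)
Lemma sum_quad_weight_swap (k l : nat) :
  \sum_(M <- quads p) quad_weight C chi M * (M.1.1%:R ^+ k * M.2.1%:R ^+ l) =
  chi (- 1) *
  \sum_(M <- quads p) quad_weight C chi M * (M.2.2%:R ^+ k * M.1.2%:R ^+ l).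
Proof.
rewrite -sum_quads_swap mulr_sumr /= big_seq_cond [RHS]big_seq_cond.
apply: eq_bigr => -[[a b] [c d]] /andP[]; rewrite mem_quads /quad_weight /=.
case/and5P=> ? ? ? ? /eqP pE _.
have p_b : ~~ (p %| b)%N by rewrite gtnNdvd //; nia.
have p_c : ~~ (p %| c)%N by rewrite gtnNdvd //; nia.
have chiE : chi a%:Z * chi b%:Z = chi (- 1) * (chi c%:Z * chi d%:Z).
  case: (chi_char) => _ _ chiM _; transitivity (chi (p - c * d)%N%:Z).
    by rewrite -chiM -PoszM; congr (chi _%:Z); nia.
  rewrite (character_subn _ _ _ chi_char); last by nia.
  by rewrite PoszM chiM.
transitivity (chi (- 1) * ((chi b)^* * chi d) * (d%:R ^+ k * b%:R ^+ l)); last by rewrite -mulrA.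
congr (_ * _).
transitivity ((chi c)^* * chi a * ((chi b)^* * chi b)).
  by rewrite (character_conjV _ _ _ p_prime chi_char _ p_b) mulr1.
transitivity ((chi b)^* * (chi c)^* * (chi a%:Z * chi b%:Z)); first by ring.
rewrite chiE; transitivity (chi (- 1) * ((chi b)^* * chi d) * ((chi c)^* * chi c)).
  by ring.
by rewrite (character_conjV _ _ _ p_prime chi_char _ p_c) mulr1.
Qed.

Variables (n : nat) (eta : nat -> C) (c : C).
Hypotheses (n_gt1 : (1 < n)%N) (beta_n : beta n = 0).
(** The division by [X] makes this homogeneous of degree [n - 1], with a simple pole at [X = 0] in
    the term [j = 0]. *)
Definition period_fun (X Y : C) := \sum_(j < n.+1) eta j * X ^+ j * Y ^+ (n - j) / X.
Hypothesis period_split : forall X Y : C, X != 0 -> X + Y != 0 ->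
  X ^+ n.-1 - Y ^+ n.-1 =
  period_fun X Y - period_fun (X + Y) Y + c * bernoulli_term C n.+1 X (X + Y).
Hypothesis period_shear : forall X Y : C, X != 0 ->
  X ^+ n.-1 - Y ^+ n.-1 = period_fun X Y - period_fun X (X + Y).
Hypothesis etaE : forall j, (j < n.-1)%N -> eta j = n.-1`!%:R * beta j / (n - j)`!%:R.

(* [period_sum], multiplied by [z] to clear the pole at [z = 0], as an identity
   of polynomials in [z] *)
Lemma period_poly :
  'X * (\sum_(M <- quads p) quad_weight C chi M *:
     ((M.1.1%:R%:P + M.2.1%:R *: 'X) ^+ n.-1 - ((- M.2.2%:R)%:P + M.1.2%:R *: 'X) ^+ n.-1)) =
  'X * (\sum_(1 <= d < p) chi d%:Z *:
     \sum_(j < n.+1) (eta j * p%:R ^+ j / p%:R) *: ((p - d)%:R%:P + 1 *: 'X) ^+ (n - j))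
  - \sum_(1 <= b < p) (chi b%:Z)^* *:
     \sum_(j < n.+1) (eta j * p%:R ^+ j / p%:R) *: ('X^j * ((- 1)%:P + b%:R *: 'X) ^+ (n - j))
  + (c * chi (- 1)) *: \sum_(i < n.+2)
      (gen_bernoulli p chi i / i`!%:R
       * (gen_bernoulli p (conj_character chi) (n.+1 - i)%N / (n.+1 - i)`!%:R))
      *: 'X^(n.+1 - i).
Proof.
apply: (@eq_poly_nat _ _ _ p) => z le_pz.
have p_gt0 := prime_gt0 p_prime; have z_gt0 := leq_trans p_gt0 le_pz.
have z_neq0 : z%:R != 0 :> C by rewrite pnatr_eq0 -lt0n.
have p_neq0 : p%:R != 0 :> C by rewrite pnatr_eq0 -lt0n.
have := period_sum _ _ _ p_prime chi_char chi_sum0 _ _ _ n_gt1 beta_n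
  period_split period_shear _ le_pz.
move/(congr1 (fun x => z%:R * x)) => rel.
rewrite !(hornerD, hornerN) !hornerM !hornerX hornerZ !horner_sum.
transitivity (z%:R * \sum_(M <- quads p) quad_weight C chi M *
     ((quad_vec1 z M)%:R ^+ n.-1 - (quad_vec2 z M)%:R ^+ n.-1)).
  congr (_ * _); rewrite big_seq_cond [RHS]big_seq_cond; apply: eq_bigr => -[[a b] [c' d]].
  case/andP=> M_in _; have [_ w_gt0] := quad_vec_gt0 _ _ _ le_pz M_in.
  rewrite !hornerE /quad_vec1 /quad_vec2 /= natrB; last first.
    by move: w_gt0; rewrite /quad_vec2 subn_gt0 => /ltnW.
  by rewrite natrD !natrM [- _ + _]addrC.
rewrite rel mulrDr mulrBr; congr (_ - _ + _).
- congr (_ * _); apply: eq_bigr => d _; rewrite !(hornerE, horner_sum); congr (_ * _).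
  by apply: eq_bigr => j _; rewrite !(hornerE, horner_exp) natrD mulrAC.
- rewrite mulr_sumr; apply: eq_big_nat => b /andP[b_gt0 _].
  rewrite mulrCA hornerZ horner_sum; congr (_ * _).
  rewrite /period_fun mulr_sumr; apply: eq_bigr => j _.
  transitivity (eta j * p%:R ^+ j / p%:R * (z%:R ^+ j * (b%:R * z%:R - 1) ^+ (n - j))).
    rewrite natrB ?muln_gt0 ?b_gt0 // !natrM exprMn.
    move: (_ ^+ (n - j)) (p%:R ^+ j) (z%:R ^+ j) => x1 x2 x3.
    by field; rewrite z_neq0 p_neq0.
  by rewrite !(hornerE, horner_exp) [- 1 + _]addrC.
rewrite mulrCA -mulrA; congr (_ * _); rewrite mulrCA; congr (_ * _); rewrite mulr_sumr.
apply: eq_bigr => i _; rewrite hornerZ hornerXn.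
move: (gen_bernoulli _ _ _ / _) (gen_bernoulli _ _ _ / _) (z%:R ^+ _) => x1 x2 x3.
by field; rewrite z_neq0.
Qed.

Variables (k l : nat).
Hypotheses (k_gt2 : (2 < k)%N) (l_gt2 : (2 < l)%N) (klE : (k + l = n.+1)%N).
Hypothesis chi_parity : chi (- 1) = (- 1) ^+ k.

Let chip0 : chi p%:Z = 0.
Proof. exact: (character_dvd _ _ _ p_prime chi_char) (dvdnn p). Qed.

Lemma fact_quotient (a i m q : nat) (x y : C) : (a = i + m)%N ->
  q`!%:R * x / a`!%:R * ('C(a, i)%:R * y) = q`!%:R / i`!%:R * (x / m`!%:R * y).
Proof.
move=> ->; have : 'C(i + m, i)%:R != 0 :> C by rewrite pnatr_eq0 -lt0n bin_gt0 leq_addr.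
have <- : ('C(i + m, i) * (i`! * m`!))%N = (i + m)`! by rewrite -(bin_fact (leq_addr m i)) addKn.
by rewrite !natrM => bin_neq0; field; rewrite bin_neq0 !fact_neq0.
Qed.

(** The parts from [v] and from [w] agree, hence the factor 2: [sum_quad_weight_swap] contributes
    [chi(-1) = (-1)^k], the power of [- d] contributes [(-1)^(k - 1)], and the resulting sign
    cancels the minus between the parts. *)
Lemma coef_quads_sum :
  ('X * (\sum_(M <- quads p) quad_weight C chi M *:
     ((M.1.1%:R%:P + M.2.1%:R *: 'X) ^+ n.-1 - ((- M.2.2%:R)%:P + M.1.2%:R *: 'X) ^+ n.-1)))`_l =
  2 * 'C(n.-1, l.-1)%:R *
  \sum_(M <- quads p) quad_weight C chi M * (M.1.1%:R ^+ k.-1 * M.2.1%:R ^+ l.-1).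
Proof.
have kE : (n.-1 - l.-1 = k.-1)%N by lia.
rewrite coefXM; case: eqP => [|_]; first by lia.
rewrite coef_sum; under eq_bigr do rewrite coefZ coefB !coef_affine_exp kE mulrBr.
rewrite sumrB; set S := \sum_(M <- quads p) _ * (M.1.1%:R ^+ _ * M.2.1%:R ^+ _).
have swapE : S = chi (- 1) * \sum_(M <- quads p) quad_weight C chi M *
    (M.2.2%:R ^+ k.-1 * M.1.2%:R ^+ l.-1) by exact: sum_quad_weight_swap.
have eps2 : chi (- 1) * chi (- 1) = 1.
  by rewrite chi_parity -expr2 sqrr_sign.
have -> : \sum_(M <- quads p) quad_weight C chi M *
    ('C(n.-1, l.-1)%:R * (M.1.1%:R ^+ k.-1 * M.2.1%:R ^+ l.-1)) = 'C(n.-1, l.-1)%:R * S.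
  by rewrite mulr_sumr; apply: eq_bigr => M _; rewrite mulrCA.
have -> : \sum_(M <- quads p) quad_weight C chi M *
    ('C(n.-1, l.-1)%:R * ((- M.2.2%:R) ^+ k.-1 * M.1.2%:R ^+ l.-1)) = - ('C(n.-1, l.-1)%:R * S).
  have signE : (- 1) ^+ k = - (- 1) ^+ k.-1 :> C.
    by case: (k) k_gt2 => // m _; rewrite exprS mulN1r.
  rewrite swapE chi_parity signE mulNr mulrN opprK !mulr_sumr.
  by apply: eq_bigr => M _; rewrite exprNn; ring.
ring.
Qed.

(** The factor ['X] shifts to coefficient [l - 1], where only [j <= k] survives; replacing [d] by
    [p - d] then produces [chi(-1)] and the expansion of [gen_bernoulli_powersum]. *)
Lemma coef_first_sum :
  ('X * (\sum_(1 <= d < p) chi d%:Z *: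
     \sum_(j < n.+1) (eta j * p%:R ^+ j / p%:R) *: ((p - d)%:R%:P + 1 *: 'X) ^+ (n - j)))`_l =
  n.-1`!%:R / l.-1`!%:R * (chi (- 1) * (gen_bernoulli p chi k / k`!%:R)).
Proof.
rewrite coefXM; case: eqP => [|_]; first by lia.
rewrite gen_bernoulli_powersum // coef_sum.
transitivity (n.-1`!%:R / l.-1`!%:R * \sum_(j < k.+1) (beta j * p%:R ^+ j / p%:R / (k - j)`!%:R) *
   \sum_(1 <= d < p) chi d%:Z * (p - d)%:R ^+ (k - j)); last first.
  congr (_ * _); rewrite mulr_sumr; apply: eq_bigr => j _.
  by rewrite (sum_character_opp _ _ _ p_prime chi_char (fun x => x%:R ^+ (k - j))) mulrCA.
under [X in _ = _ * X]eq_bigr do rewrite mulr_sumr.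
rewrite exchange_big mulr_sumr; apply: eq_bigr => d _.
rewrite coefZ coef_sum !mulr_sumr.
have le_kn : (k <= n)%N by lia.
rewrite (big_ord_widen_cond n.+1 xpredT (fun j : nat => n.-1`!%:R / l.-1`!%:R *
   (beta j * p%:R ^+ j / p%:R / (k - j)`!%:R * (chi d%:Z * (p - d)%:R ^+ (k - j))))) //.
rewrite [RHS]big_mkcond; apply: eq_bigr => -[j lt_jn] _ /=.
rewrite coefZ coef_affine_exp expr1n mulr1; case: ltnP => [le_jk|lt_kj]; last first.
  by rewrite bin_small ?mul0r ?mulr0 //; lia.
(* [2 < l] gives [j <= k < n - 1], which avoids the indices [n - 1] and [n] not covered by
   [etaE]. *)
rewrite etaE; last by lia.
have -> : (n - j - l.-1 = k - j)%N by lia.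
transitivity (n.-1`!%:R * (beta j * p%:R ^+ j / p%:R) / (n - j)`!%:R *
  ('C(n - j, l.-1)%:R * (chi d%:Z * (p - d)%:R ^+ (k - j)))); first by ring.
by rewrite (@fact_quotient _ _ (k - j)); [ring|lia].
Qed.

(** The sign is [(-1)^(n - l)], from the constant term of [b z - 1]. *)
Lemma coef_last_sum :
  (\sum_(1 <= b < p) (chi b%:Z)^* *:
     \sum_(j < n.+1) (eta j * p%:R ^+ j / p%:R) *: ('X^j * ((- 1)%:P + b%:R *: 'X) ^+ (n - j)))`_l =
  n.-1`!%:R / k.-1`!%:R * ((- 1) ^+ k.-1 * (gen_bernoulli p (conj_character chi) l / l`!%:R)).
Proof.
rewrite gen_bernoulli_powersum ?/conj_character ?chip0 ?rmorph0 // coef_sum.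
rewrite mulrA mulr_sumr; under [RHS]eq_bigr do rewrite !mulr_sumr.
rewrite exchange_big; apply: eq_bigr => b _.
rewrite coefZ coef_sum !mulr_sumr.
have le_ln : (l <= n)%N by lia.
rewrite (big_ord_widen_cond n.+1 xpredT (fun j : nat => n.-1`!%:R / k.-1`!%:R * (- 1) ^+ k.-1 *
   (beta j * p%:R ^+ j / p%:R / (l - j)`!%:R * ((chi b%:Z)^* * b%:R ^+ (l - j))))) //.
rewrite [RHS]big_mkcond; apply: eq_bigr => -[j lt_jn] _ /=.
rewrite coefZ coefXnM ltnS; case: leqP => [le_jl|_]; last by rewrite !mulr0.
rewrite coef_affine_exp etaE; last by lia.
have -> : (n - j - (l - j) = k.-1)%N by lia.
rewrite -(bin_sub (_ : l - j <= n - j)%N); last by lia.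
have -> : (n - j - (l - j) = k.-1)%N by lia.
transitivity (n.-1`!%:R * (beta j * p%:R ^+ j / p%:R) / (n - j)`!%:R *
  ('C(n - j, k.-1)%:R * ((chi b%:Z)^* * ((- 1) ^+ k.-1 * b%:R ^+ (l - j))))); first by ring.
by rewrite (@fact_quotient _ _ (l - j)); [ring|lia].
Qed.

(** This is the coefficient of [z ^ l] in [period_poly], divided by [2 'C(n - 1, l - 1)]; among the
    products of generalized Bernoulli numbers only [i = k] has degree [l]. *)
Lemma quads_sum :
  \sum_(M <- quads p) quad_weight C chi M * (M.1.1%:R ^+ k.-1 * M.2.1%:R ^+ l.-1) =
  chi (- 1) * (gen_bernoulli p chi k / (2 * k%:R)
    + gen_bernoulli p (conj_character chi) l / (2 * l%:R)
    + c * (gen_bernoulli p chi k * gen_bernoulli p (conj_character chi) l)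
      / (2 * k%:R * l%:R * n.-1`!%:R)).
Proof.
have := congr1 (fun P : {poly C} => P`_l) period_poly.
have coef_lk (f : nat -> C) : (\sum_(i < n.+2) f i *: 'X^(n.+1 - i))`_l = f k.
  have lt_k : (k < n.+2)%N by lia.
  rewrite coef_sum (bigD1 (Ordinal lt_k)) //= big1 ?addr0 => [|i ne_ik].
    by rewrite coefZ coefXn -klE addKn eqxx mulr1.
  rewrite coefZ coefXn; case: eqP => [lE|_]; last by rewrite mulr0.
  by case/eqP: ne_ik; apply: val_inj; rewrite /=; have := ltn_ord i; lia.
rewrite /= coef_quads_sum coefD coefB coef_first_sum coef_last_sum coefZ.
rewrite (coef_lk (fun i => gen_bernoulli p chi i / i`!%:R
  * (gen_bernoulli p (conj_character chi) (n.+1 - i)%N / (n.+1 - i)`!%:R))).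
rewrite -[in (n.+1 - k)%N]klE addKn => rel.
have binE : ('C(n.-1, l.-1) * (l.-1`! * k.-1`!))%N = n.-1`!.
  by rewrite -(@bin_fact n.-1 l.-1); [congr (_ * (_ * _`!))%N|]; lia.
have k_neq0 : k%:R != 0 :> C by rewrite pnatr_eq0; lia.
have l_neq0 : l%:R != 0 :> C by rewrite pnatr_eq0; lia.
have kE : k`!%:R = k%:R * k.-1`!%:R :> C by case: (k) k_gt2 => // m _; rewrite factS natrM.
have lE : l`!%:R = l%:R * l.-1`!%:R :> C by case: (l) l_gt2 => // m _; rewrite factS natrM.
have bin_neq0 : 2 * 'C(n.-1, l.-1)%:R != 0 :> C.
  by rewrite -natrM pnatr_eq0 -lt0n muln_gt0 bin_gt0; lia.
apply: (mulfI bin_neq0); rewrite rel kE lE -binE !natrM.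
have -> : chi (- 1) = - (- 1) ^+ k.-1.
  by rewrite chi_parity; case: (k) k_gt2 => // m _; rewrite exprS mulN1r.
move: bin_neq0; rewrite mulf_eq0 negb_or => /andP[_ bin_neq0].
by field; rewrite k_neq0 l_neq0 bin_neq0 !fact_neq0.
Qed.
End ConvolutionSum.

(** * Numerical verification in weights 6, 8, 10 and 14 *)

Section BernoulliValues.
Variable F : numFieldType.

Local Notation beta := (fps_inv (fps_expm1_div (1 : F))).

Lemma betaS n : beta n.+1 = - \sum_(i < n.+1) beta i / (n - i).+2`!%:R.
Proof.
rewrite fps_invS // /fps_expm1_div /fps_exp expr1n divr1 invr1 mulN1r.
congr (- _); apply: eq_bigr => i _; rewrite expr1n mul1r subSn //.
by rewrite -ltnS.
Qed.

Lemma beta0 : beta 0%N = 1.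
Proof. by rewrite /fps_inv /= /fps_expm1_div /fps_exp expr1n divr1 invr1. Qed.

(* The factorials are kept behind an abstract [u], since their unary normal forms
   are out of reach. *)
Lemma inv_factorials : exists u : nat -> F,
  (forall n, beta n.+1 = - \sum_(i < n.+1) beta i * u (n - i).+2) /\
  [/\ u 2%N = 1 / 2 & forall n, u n.+1 = u n / n.+1%:R].
Proof.
exists (fun n => (n`!%:R)^-1); split; first exact: betaS.
by split=> [|n]; rewrite ?div1r // factS natrM invfM mulrC.
Qed.

(** The values are [B_j / j!], with the large factorials left factored to keep the numerals
    small. *)
Lemma beta_values :
  [/\ beta 1%N = - 1 / 2, beta 2%N = 1 / 12, beta 3%N = 0 & beta 4%N = - 1 / 720] /\
  [/\ beta 5%N = 0, beta 6%N = 1 / (720 * 42), beta 7%N = 0 & beta 8%N = - 1 / (720 * 1680)] /\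
  [/\ beta 9%N = 0, beta 10%N = 1 / (720 * 5040) * (5 / 66) & beta 11%N = 0] /\
  [/\ beta 12%N = - (1 / (720 * 5040 * 132) * (691 / 2730)), beta 13%N = 0 &
      beta 14%N = 1 / (720 * 5040 * 132 * 182) * (7 / 6)].
Proof.
have b0 := beta0; have [u [rec [u2 uS]]] := inv_factorials.
have us := (uS 14%N, uS 13%N, uS 12%N, uS 11%N, uS 10%N, uS 9%N,
  uS 8%N, uS 7%N, uS 6%N, uS 5%N, uS 4%N, uS 3%N, uS 2%N, u2).
have b1 : beta 1%N = - 1 / 2.
  by rewrite rec !big_ord_recr big_ord0 /= ?subSS ?subn0 b0 !us; field.
have b2 : beta 2%N = 1 / 12.
  by rewrite rec !big_ord_recr big_ord0 /= ?subSS ?subn0 b0 b1 !us; field.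
have b3 : beta 3%N = 0.
  by rewrite rec !big_ord_recr big_ord0 /= ?subSS ?subn0 b0 b1 b2 !us; field.
have b4 : beta 4%N = - 1 / 720.
  by rewrite rec !big_ord_recr big_ord0 /= ?subSS ?subn0 b0 b1 b2 b3 !us; field.
have b5 : beta 5%N = 0.
  by rewrite rec !big_ord_recr big_ord0 /= ?subSS ?subn0 b0 b1 b2 b3 b4 !us; field.
have b6 : beta 6%N = 1 / (720 * 42).
  by rewrite rec !big_ord_recr big_ord0 /= ?subSS ?subn0 b0 b1 b2 b3 b4 b5 !us; field.
have b7 : beta 7%N = 0.
  by rewrite rec !big_ord_recr big_ord0 /= ?subSS ?subn0 b0 b1 b2 b3 b4 b5 b6 !us; field.
have b8 : beta 8%N = - 1 / (720 * 1680).
  by rewrite rec !big_ord_recr big_ord0 /= ?subSS ?subn0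
    b0 b1 b2 b3 b4 b5 b6 b7 !us; field.
have b9 : beta 9%N = 0.
  by rewrite rec !big_ord_recr big_ord0 /= ?subSS ?subn0
    b0 b1 b2 b3 b4 b5 b6 b7 b8 !us; field.
have b10 : beta 10%N = 1 / (720 * 5040) * (5 / 66).
  by rewrite rec !big_ord_recr big_ord0 /= ?subSS ?subn0
    b0 b1 b2 b3 b4 b5 b6 b7 b8 b9 !us; field.
have b11 : beta 11%N = 0.
  by rewrite rec !big_ord_recr big_ord0 /= ?subSS ?subn0
    b0 b1 b2 b3 b4 b5 b6 b7 b8 b9 b10 !us; field.
have b12 : beta 12%N = - (1 / (720 * 5040 * 132) * (691 / 2730)).
  by rewrite rec !big_ord_recr big_ord0 /= ?subSS ?subn0
    b0 b1 b2 b3 b4 b5 b6 b7 b8 b9 b10 b11 !us; field.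
have b13 : beta 13%N = 0.
  by rewrite rec !big_ord_recr big_ord0 /= ?subSS ?subn0
    b0 b1 b2 b3 b4 b5 b6 b7 b8 b9 b10 b11 b12 !us; field.
have b14 : beta 14%N = 1 / (720 * 5040 * 132 * 182) * (7 / 6).
  by rewrite rec !big_ord_recr big_ord0 /= ?subSS ?subn0
    b0 b1 b2 b3 b4 b5 b6 b7 b8 b9 b10 b11 b12 b13 !us; field.
by do !split.
Qed.
End BernoulliValues.

(** * Eisenstein period functions *)

Section EisensteinPeriods.
Variable C : numClosedFieldType.

Local Notation beta := (fps_inv (fps_expm1_div (1 : C))).

(* With these coefficients [period_fun] is
   [X ^ (n - 1) * (B_n(Y / X) / n - Y / X + 1 / 2)], where [B_n] is the Bernoulli
   polynomial; its difference equation is the shear relation. *)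
Definition eisenstein_eta (n j : nat) : C :=
  n.-1`!%:R * beta j / (n - j)`!%:R - (j == n.-1)%:R + (j == n)%:R / 2.

(** Forced by the pole of the split relation at [X = 0]: [period_fun] has residue [Y^n / n] there,
    and [bernoulli_term] has residue [beta n.+1] times [Y^n]. *)
Definition eisenstein_const (n : nat) : C := - (n%:R * beta n.+1)^-1.

(** The quotients [(n - 1)! / (n - j)!] are hidden behind [r] and reached through successive ratios,
    so that no factorial has to be expanded. *)
Lemma fact_ratios n : (0 < n)%N -> exists r : nat -> C,
  [/\ forall j, eisenstein_eta n j = r j * beta j - (j == n.-1)%:R + (j == n)%:R / 2,
      r 0%N = 1 / n%:R & forall j, (j < n)%N -> r j.+1 = r j * (n - j)%:R].
Proof.
move=> n_gt0; have fact_neq0 m : m`!%:R != 0 :> C by rewrite pnatr_eq0 -lt0n fact_gt0.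
exists (fun j => n.-1`!%:R / (n - j)`!%:R); split.
- by move=> j; rewrite /eisenstein_eta mulrAC.
- case: n n_gt0 => // n _; rewrite subn0 factS natrM /=.
  by rewrite invfM mulrCA divff // mulr1 div1r.
move=> j lt_jn; rewrite subnS.
case: (n - j)%N (subn_gt0 j n) => [|m _]; first by rewrite lt_jn.
by rewrite factS natrM /= invfM [_^-1 * _]mulrC mulrA mulfVK // pnatr_eq0.
Qed.

(* The shear relation holds for every [n]; the split relation expresses that
   SL_2(Z) has no cusp forms of weight [n + 1] and fails for [n = 11]. *)
Definition period_relations n := forall X Y : C, X != 0 ->
  (X + Y != 0 ->
   X ^+ n.-1 - Y ^+ n.-1 =
   period_fun C n (eisenstein_eta n) X Y - period_fun C n (eisenstein_eta n) (X + Y) Y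
   + eisenstein_const n * bernoulli_term C n.+1 X (X + Y)) /\
  X ^+ n.-1 - Y ^+ n.-1 =
  period_fun C n (eisenstein_eta n) X Y - period_fun C n (eisenstein_eta n) X (X + Y).

(** Once the Bernoulli values are substituted, both relations are identities of rational functions
    in [X] and [Y]. *)
Lemma period_relations5 : period_relations 5.
Proof.
have [[b1 b2 b3 b4] [[b5 b6 b7 b8] [[b9 b10 b11] [b12 b13 b14]]]] := beta_values C.
have bs := (b1, b2, b3, b4, b5, b6, beta0 C).
have [r [etaE r0 rS]] := fact_ratios 5 isT.
have rs := (rS 4%N isT, rS 3%N isT, rS 2%N isT, rS 1%N isT, rS 0%N isT, r0).
move=> X Y X_neq0; split=> [XY_neq0|]; rewrite /period_fun /bernoulli_term /eisenstein_const;
  rewrite !big_ord_recr !big_ord0 /= !etaE /= !rs ?subSS ?subn0 !bs.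
  by field; rewrite XY_neq0 X_neq0.
by field.
Qed.

Lemma period_relations7 : period_relations 7.
Proof.
have [[b1 b2 b3 b4] [[b5 b6 b7 b8] [[b9 b10 b11] [b12 b13 b14]]]] := beta_values C.
have bs := (b1, b2, b3, b4, b5, b6, b7, b8, beta0 C).
have [r [etaE r0 rS]] := fact_ratios 7 isT.
have rs := (rS 6%N isT, rS 5%N isT, rS 4%N isT, rS 3%N isT, rS 2%N isT, rS 1%N isT, rS 0%N isT, r0).
move=> X Y X_neq0; split=> [XY_neq0|]; rewrite /period_fun /bernoulli_term /eisenstein_const;
  rewrite !big_ord_recr !big_ord0 /= !etaE /= !rs ?subSS ?subn0 !bs.
  by field; rewrite XY_neq0 X_neq0.
by field.
Qed.

Lemma period_relations9 : period_relations 9.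
Proof.
have [[b1 b2 b3 b4] [[b5 b6 b7 b8] [[b9 b10 b11] [b12 b13 b14]]]] := beta_values C.
have bs := (b1, b2, b3, b4, b5, b6, b7, b8, b9, b10, beta0 C).
have [r [etaE r0 rS]] := fact_ratios 9 isT.
have rs := (rS 8%N isT, rS 7%N isT,
  rS 6%N isT, rS 5%N isT, rS 4%N isT, rS 3%N isT, rS 2%N isT, rS 1%N isT, rS 0%N isT, r0).
move=> X Y X_neq0; split=> [XY_neq0|]; rewrite /period_fun /bernoulli_term /eisenstein_const;
  rewrite !big_ord_recr !big_ord0 /= !etaE /= !rs ?subSS ?subn0 !bs.
  by field; rewrite XY_neq0 X_neq0.
by field.
Qed.

Lemma period_relations13 : period_relations 13.
Proof.
have [[b1 b2 b3 b4] [[b5 b6 b7 b8] [[b9 b10 b11] [b12 b13 b14]]]] := beta_values C.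
have bs := (b1, b2, b3, b4, b5, b6, b7, b8, b9, b10, b11, b12, b13, b14, beta0 C).
have [r [etaE r0 rS]] := fact_ratios 13 isT.
have rs := (rS 12%N isT, rS 11%N isT, rS 10%N isT, rS 9%N isT, rS 8%N isT, rS 7%N isT,
  rS 6%N isT, rS 5%N isT, rS 4%N isT, rS 3%N isT, rS 2%N isT, rS 1%N isT, rS 0%N isT, r0).
move=> X Y X_neq0; split=> [XY_neq0|]; rewrite /period_fun /bernoulli_term /eisenstein_const;
  rewrite !big_ord_recr !big_ord0 /= !etaE /= !rs ?subSS ?subn0 !bs.
  by field; rewrite XY_neq0 X_neq0.
by field.
Qed.

End EisensteinPeriods.

(** * The convolution formula *)

Lemma ratr_bernoulli (C : numClosedFieldType) n :
  ratr (bernoulli n) = n`!%:R * fps_inv (fps_expm1_div 1) n :> C.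
Proof.
rewrite /bernoulli rmorphM rmorph_nat /=; congr (_ * _).
elim/ltn_ind: n => -[|n] IHn; first by rewrite !beta0 rmorph1.
rewrite !betaS rmorphN rmorph_sum /=; congr (- _); apply: eq_bigr => i _.
by rewrite fmorph_div rmorph_nat /= IHn.
Qed.

Section SigmaConvolution.
Variables (C : numClosedFieldType) (p : nat) (chi : int -> C).
Hypotheses (p_prime : prime p) (chi_char : dirichlet_character p chi).

(** Divisors of a positive [m <= p] are at most [p], so all divisor sums can share one range; no
    pair has product 0, which matches the value at [m = 0]. *)
Lemma sigma1_pairs e (psi : int -> C) m : (m <= p)%N ->
  sigma1 e psi m =
  \sum_(x <- [seq (a, b) | a <- iota 1 p, b <- iota 1 p])
    if (x.1 * x.2 == m)%N then psi x.2%:Z * x.1%:R ^+ e else 0.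
Proof.
move=> le_mp; rewrite big_allpairs_dep /sigma1 -/(index_iota 1 p.+1).
have iotaE : iota 1 p = index_iota 1 p.+1 by rewrite /index_iota subn1.
rewrite iotaE [RHS](big_cat_nat (n := m.+1)) //=.
rewrite [X in _ = _ + X]big_nat [X in _ = _ + X]big1 ?addr0 => [|a /andP[lt_ma _]].
  apply: eq_big_nat => a /andP[a_gt0 _].
  rewrite big_mkcond [RHS](big_cat_nat (n := m.+1)) //=.
  rewrite [X in _ = _ + X]big_nat [X in _ = _ + X]big1 ?addr0 // => b /andP[lt_mb _].
  by case: eqP => // abm; nia.
rewrite big_nat big1 // => b /andP[b_gt0 _].
by case: eqP => // abm; nia.
Qed.

Lemma sum_sigma1_quads k l :
  \sum_(1 <= n < p.+1) sigma1 k (conj_character chi) n * sigma1 l chi (p - n)%N =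
  \sum_(M <- quads p) quad_weight C chi M * (M.1.1%:R ^+ k * M.2.1%:R ^+ l).
Proof.
rewrite [RHS]big_filter [RHS]big_mkcond [RHS]big_allpairs_dep.
set s := [seq _ | _ <- _, _ <- _].
have s_gt0 x : x \in s -> (0 < x.1)%N /\ (0 < x.2)%N.
  by case/allpairsP=> -[a b] [/= a_in b_in ->]; move: a_in b_in; rewrite !mem_iota /=; lia.
transitivity (\sum_(1 <= n < p.+1) \sum_(x <- s) \sum_(y <- s)
    (if (x.1 * x.2 == n)%N then conj_character chi x.2%:Z * x.1%:R ^+ k else 0) *
    (if (y.1 * y.2 == p - n)%N then chi y.2%:Z * y.1%:R ^+ l else 0)).
  apply: eq_big_nat => n /andP[_ le_np].
  rewrite !sigma1_pairs ?leq_subr // mulr_suml.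
  by apply: eq_bigr => x _; rewrite mulr_sumr.
rewrite exchange_big /= big_seq [RHS]big_seq; apply: eq_bigr => x x_in.
rewrite exchange_big /= big_seq [RHS]big_seq; apply: eq_bigr => y y_in.
have [x1_gt0 x2_gt0] := s_gt0 _ x_in; have [y1_gt0 y2_gt0] := s_gt0 _ y_in.
have [xyp|ne_xyp] := eqVneq (x.1 * x.2 + y.1 * y.2)%N p; last first.
  rewrite big_nat big1 // => n /andP[n_gt0 le_np].
  case: eqP => [xn|]; rewrite ?mul0r //; case: eqP => [yn|]; rewrite ?mulr0 //.
  by case/eqP: ne_xyp; rewrite xn yn subnKC.
(* Only [n = x.1 * x.2] contributes, and it lies below [p] because the other product is positive. *)
have u_gt0 : (0 < x.1 * x.2)%N by rewrite muln_gt0 x1_gt0.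
have v_gt0 : (0 < y.1 * y.2)%N by rewrite muln_gt0 y1_gt0.
have lt_up : (x.1 * x.2 < p)%N by rewrite -xyp -[X in (X < _)%N]addn0 ltn_add2l.
rewrite (big_cat_nat (n := (x.1 * x.2)%N)) ?(ltnW (ltnW lt_up)) //=; last exact/ltnW/ltnW.
rewrite [X in _ + X = _](big_cat_nat (n := (x.1 * x.2).+1)) //=; last exact/ltnW.
rewrite big_nat1 eqxx -[in (p - _)%N]xyp addKn eqxx.
rewrite big_nat big1 => [|n /andP[_ lt_n]]; last by rewrite gtn_eqF ?mul0r.
rewrite [X in _ + (_ + X)]big_nat [X in _ + (_ + X)]big1 => [|n /andP[lt_n _]];
  last by rewrite ltn_eqF ?mul0r.
by rewrite add0r addr0 /quad_weight /conj_character /=; ring.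
Qed.

Hypothesis chi_sum0 : \sum_(1 <= x < p) chi x%:Z = 0.

(** Here [k] and [l] are exponents, one below the weights of [quads_sum];
    [eisenstein_const C n / (n - 1)!] becomes [- (n + 1) / B_(n+1)]. *)
Lemma sigma1_convolution n k l : (1 < k)%N -> (1 < l)%N -> (k + l).+1 = n ->
  fps_inv (fps_expm1_div 1) n = 0 :> C -> period_relations C n ->
  chi (- 1) = (- 1) ^+ k.+1 ->
  \sum_(1 <= m < p.+1) sigma1 k (conj_character chi) m * sigma1 l chi (p - m)%N =
  chi (- 1) * (gen_bernoulli p chi k.+1 / (2 * k.+1%:R)
    + gen_bernoulli p (conj_character chi) l.+1 / (2 * l.+1%:R)
    - n.+1%:R * (gen_bernoulli p chi k.+1 * gen_bernoulli p (conj_character chi) l.+1)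
      / (2 * k.+1%:R * l.+1%:R * ratr (bernoulli n.+1))).
Proof.
move=> k_gt1 l_gt1 nE beta_n rel chi_parity.
have n_gt1 : (1 < n)%N by lia.
rewrite sum_sigma1_quads.
rewrite (quads_sum _ _ _ p_prime chi_char chi_sum0 n (eisenstein_eta C n)
  (eisenstein_const C n) _ _ _ _ _ k.+1 l.+1) //; last by lia.
- congr (_ * (_ + _)); rewrite ratr_bernoulli factS natrM.
  have -> : n`!%:R = n%:R * n.-1`!%:R :> C by case: (n) n_gt1 => // m _; rewrite factS natrM.
  rewrite /eisenstein_const mulNr mulNr -!mulrA; congr (- _).
  rewrite !invfM; have : n.+1%:R != 0 :> C by rewrite pnatr_eq0.
  move: (fps_inv _ _)^-1 (n%:R)^-1 n.-1`!%:R^-1 (k.+1%:R)^-1 (l.+1%:R)^-1 n.+1%:R.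
  by move=> x1 x2 x3 x4 x5 x6 x6_neq0; field.
- by move=> X Y X_neq0 XY_neq0; case: (rel X Y X_neq0) => ->.
- by move=> X Y X_neq0; case: (rel X Y X_neq0).
move=> j lt_jn; rewrite /eisenstein_eta.
have -> : (j == n.-1) = false by lia.
have -> : (j == n) = false by lia.
by rewrite subr0 mul0r addr0.
Qed.
End SigmaConvolution.

(** * Primitive characters modulo [p] and the ten identities *)

Lemma primitive_sum0 (C : numClosedFieldType) (p : nat) (chi : int -> C) :
  prime p -> primitive_character p chi -> \sum_(1 <= x < p) chi x%:Z = 0.
Proof.
move=> p_prime [chi_char chi_prim]; have p_gt1 := prime_gt1 p_prime.
have [[n chi_n p_n]|triv] := pselect (exists2 n : nat, chi n%:Z != 1 & ~~ (p %| n)%N).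
  exact: sum_character0 chi_n p_n.
(* Otherwise [chi] is 1 at all integers prime to [p], so it is induced from the constant character
   modulo 1, against primitivity. *)
case: (chi_prim 1%N) => //; exists (fun=> 1); split.
  by split=> // [? ?|a]; rewrite ?mulr1 ?oner_eq0 // coprimezE coprimen1.
have chi1 n : ~~ (p %| n)%N -> chi n%:Z = 1.
  by move=> p_n; apply: contra_notP triv => /eqP chi_n; exists n.
have chiN1 : chi (- 1) = 1.
  have := character_subn _ _ _ chi_char _ (ltnW p_gt1).
  rewrite (character1 _ _ _ chi_char) mulr1 => <-; apply: chi1.
  by rewrite gtnNdvd //; lia.
move=> a; rewrite coprimezE absz_nat coprime_sym prime_coprime //.
case: a => n p_n; first exact: chi1.
case: chi_char => _ _ chiM _.
by rewrite NegzE -[- _]mulN1r chiM chiN1 mul1r chi1.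
Qed.

Theorem theorem5p1 (R : realType) (p : nat) (chi : int -> R[i])
    (p_gt2 : (2 < p)%N) (p_prime : prime p)
    (chi_prim : primitive_character p chi) :
  (chi (-1) = -1 ->
   (\sum_(1 <= n < p.+1)
       sigma1 2 (conj_character chi) n * sigma1 2 chi (p - n)%N =
       - (gen_bernoulli p (conj_character chi) 3 / 6)
       - gen_bernoulli p chi 3 / 6
       + gen_bernoulli p (conj_character chi) 3 *
         gen_bernoulli p chi 3 / (3 * ratr (bernoulli 6)) /\
     \sum_(1 <= n < p.+1)
       sigma1 2 (conj_character chi) n * sigma1 4 chi (p - n)%N =
       - (gen_bernoulli p (conj_character chi) 5 / 10)
       - gen_bernoulli p chi 3 / 6
       + 4 * gen_bernoulli p (conj_character chi) 5 *
         gen_bernoulli p chi 3 / (15 * ratr (bernoulli 8)) /\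
     \sum_(1 <= n < p.+1)
       sigma1 2 (conj_character chi) n * sigma1 6 chi (p - n)%N =
       - (gen_bernoulli p (conj_character chi) 7 / 14)
       - gen_bernoulli p chi 3 / 6
       + 5 * gen_bernoulli p (conj_character chi) 7 *
         gen_bernoulli p chi 3 / (21 * ratr (bernoulli 10)) /\
     \sum_(1 <= n < p.+1)
       sigma1 2 (conj_character chi) n * sigma1 10 chi (p - n)%N =
       - (gen_bernoulli p (conj_character chi) 11 / 22)
       - gen_bernoulli p chi 3 / 6
       + 7 * gen_bernoulli p (conj_character chi) 11 *
         gen_bernoulli p chi 3 / (33 * ratr (bernoulli 14)) /\
     \sum_(1 <= n < p.+1)
       sigma1 4 (conj_character chi) n * sigma1 4 chi (p - n)%N =
       - (gen_bernoulli p (conj_character chi) 5 / 10)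
       - gen_bernoulli p chi 5 / 10
       + gen_bernoulli p (conj_character chi) 5 *
         gen_bernoulli p chi 5 / (5 * ratr (bernoulli 10)) /\
     \sum_(1 <= n < p.+1)
       sigma1 4 (conj_character chi) n * sigma1 8 chi (p - n)%N =
       - (gen_bernoulli p (conj_character chi) 9 / 18)
       - gen_bernoulli p chi 5 / 10
       + 7 * gen_bernoulli p (conj_character chi) 9 *
         gen_bernoulli p chi 5 / (45 * ratr (bernoulli 14)) /\
     \sum_(1 <= n < p.+1)
       sigma1 6 (conj_character chi) n * sigma1 6 chi (p - n)%N =
       - (gen_bernoulli p (conj_character chi) 7 / 14)
       - gen_bernoulli p chi 7 / 14
       + gen_bernoulli p (conj_character chi) 7 *
         gen_bernoulli p chi 7 / (7 * ratr (bernoulli 14)))) /\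
  (chi (-1) = 1 ->
   (\sum_(1 <= n < p.+1)
       sigma1 3 (conj_character chi) n * sigma1 3 chi (p - n)%N =
       gen_bernoulli p (conj_character chi) 4 / 8
       + gen_bernoulli p chi 4 / 8
       - gen_bernoulli p (conj_character chi) 4 *
         gen_bernoulli p chi 4 / (4 * ratr (bernoulli 8)) /\
     \sum_(1 <= n < p.+1)
       sigma1 3 (conj_character chi) n * sigma1 5 chi (p - n)%N =
       gen_bernoulli p (conj_character chi) 6 / 12
       + gen_bernoulli p chi 4 / 8
       - 5 * gen_bernoulli p (conj_character chi) 6 *
         gen_bernoulli p chi 4 / (24 * ratr (bernoulli 10)) /\
     \sum_(1 <= n < p.+1)
       sigma1 3 (conj_character chi) n * sigma1 9 chi (p - n)%N =
       gen_bernoulli p (conj_character chi) 10 / 20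
       + gen_bernoulli p chi 4 / 8
       - 7 * gen_bernoulli p (conj_character chi) 10 *
         gen_bernoulli p chi 4 / (40 * ratr (bernoulli 14)))).
Proof.
case: (chi_prim) => chi_char _; have chi_sum0 := primitive_sum0 _ _ _ p_prime chi_prim.
have [[b1 b2 b3 b4] [[b5 b6 b7 b8] [[b9 b10 b11] [b12 b13 b14]]]] := beta_values R[i].
have conv := sigma1_convolution _ _ _ p_prime chi_char chi_sum0.
have bernoulli_neq0 n : fps_inv (fps_expm1_div 1) n != 0 :> R[i] ->
    ratr (bernoulli n) != 0 :> R[i].
  by move=> bn; rewrite ratr_bernoulli mulf_neq0 // pnatr_eq0 -lt0n fact_gt0.
have nz n : n.+1%:R != 0 :> R[i] by rewrite pnatr_eq0.
have B6 : ratr (bernoulli 6) != 0 :> R[i].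
  by apply: bernoulli_neq0; rewrite b6 div1r; exact: invr_neq0 (mulf_neq0 (nz _) (nz _)).
have B8 : ratr (bernoulli 8) != 0 :> R[i].
  apply: bernoulli_neq0; rewrite b8 mulN1r oppr_eq0.
  exact: invr_neq0 (mulf_neq0 (nz _) (nz _)).
have B10 : ratr (bernoulli 10) != 0 :> R[i].
  apply: bernoulli_neq0; rewrite b10 div1r.
  exact: mulf_neq0 (invr_neq0 (mulf_neq0 (nz _) (nz _))) (mulf_neq0 (nz _) (invr_neq0 (nz _))).
have B14 : ratr (bernoulli 14) != 0 :> R[i].
  apply: bernoulli_neq0; rewrite b14 div1r; apply: mulf_neq0.
    apply: invr_neq0; apply: mulf_neq0; last exact: nz.
    exact: mulf_neq0 (mulf_neq0 (nz _) (nz _)) (nz _).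
  exact: mulf_neq0 (nz _) (invr_neq0 (nz _)).
(* The generalized Bernoulli numbers are abstracted before [field], which would
   otherwise try to evaluate them. *)
split=> chiN1.
  have parity k : odd k -> chi (- 1) = (- 1) ^+ k.
    by move=> odd_k; rewrite chiN1 -signr_odd odd_k.
  split.
    rewrite (conv 5%N 2%N 2%N isT isT erefl b5 (period_relations5 _) (parity 3%N isT)) chiN1.
    move: B6; move: (gen_bernoulli p chi 3) (gen_bernoulli p (conj_character chi) 3).
    by move: (ratr (bernoulli 6)) => b x y b_neq0; field.
  split.
    rewrite (conv 7%N 2%N 4%N isT isT erefl b7 (period_relations7 _) (parity 3%N isT)) chiN1.
    move: B8; move: (gen_bernoulli p chi 3) (gen_bernoulli p (conj_character chi) 5).
    by move: (ratr (bernoulli 8)) => b x y b_neq0; field.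
  split.
    rewrite (conv 9%N 2%N 6%N isT isT erefl b9 (period_relations9 _) (parity 3%N isT)) chiN1.
    move: B10; move: (gen_bernoulli p chi 3) (gen_bernoulli p (conj_character chi) 7).
    by move: (ratr (bernoulli 10)) => b x y b_neq0; field.
  split.
    rewrite (conv 13%N 2%N 10%N isT isT erefl b13 (period_relations13 _) (parity 3%N isT)) chiN1.
    move: B14; move: (gen_bernoulli p chi 3) (gen_bernoulli p (conj_character chi) 11).
    by move: (ratr (bernoulli 14)) => b x y b_neq0; field.
  split.
    rewrite (conv 9%N 4%N 4%N isT isT erefl b9 (period_relations9 _) (parity 5%N isT)) chiN1.
    move: B10; move: (gen_bernoulli p chi 5) (gen_bernoulli p (conj_character chi) 5).
    by move: (ratr (bernoulli 10)) => b x y b_neq0; field.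
  split.
    rewrite (conv 13%N 4%N 8%N isT isT erefl b13 (period_relations13 _) (parity 5%N isT)) chiN1.
    move: B14; move: (gen_bernoulli p chi 5) (gen_bernoulli p (conj_character chi) 9).
    by move: (ratr (bernoulli 14)) => b x y b_neq0; field.
    rewrite (conv 13%N 6%N 6%N isT isT erefl b13 (period_relations13 _) (parity 7%N isT)) chiN1.
  move: B14; move: (gen_bernoulli p chi 7) (gen_bernoulli p (conj_character chi) 7).
  by move: (ratr (bernoulli 14)) => b x y b_neq0; field.
have parity k : ~~ odd k -> chi (- 1) = (- 1) ^+ k.
  by move=> even_k; rewrite chiN1 -signr_odd (negPf even_k).
split.
  rewrite (conv 7%N 3%N 3%N isT isT erefl b7 (period_relations7 _) (parity 4%N isT)) chiN1.
  move: B8; move: (gen_bernoulli p chi 4) (gen_bernoulli p (conj_character chi) 4).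
  by move: (ratr (bernoulli 8)) => b x y b_neq0; field.
split.
  rewrite (conv 9%N 3%N 5%N isT isT erefl b9 (period_relations9 _) (parity 4%N isT)) chiN1.
  move: B10; move: (gen_bernoulli p chi 4) (gen_bernoulli p (conj_character chi) 6).
  by move: (ratr (bernoulli 10)) => b x y b_neq0; field.
rewrite (conv 13%N 3%N 9%N isT isT erefl b13 (period_relations13 _) (parity 4%N isT)) chiN1.
move: B14; move: (gen_bernoulli p chi 4) (gen_bernoulli p (conj_character chi) 10).
by move: (ratr (bernoulli 14)) => b x y b_neq0; field.
Qed.
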